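(* Let $F=\alpha\phi(\beta/\alpha)$ be a non-trivial projectively flat $(\alpha,\beta)$-metric on an open subset $U\subseteq\mathbb R^n$ with $n\ge3$. Then there exists a closed 1-form $\theta=\theta_i(x)y^i$ on $U$ such that $F+\theta$ is a reversible projectively flat $(\alpha,\beta)$-metric.
   Context: A Finsler metric on $U$ is a continuous $F:TU\to[0,\infty)$ that is $C^\infty$ on $TU\setminus\{0\}$, satisfies $F(x,\lambda y)=\lambda F(x,y)$ for $\lambda>0$, and has $[\frac12F^2]_{y^iy^j}$ positive definite for $y\ne0$. It is reversible if $F(x,\lambda y)=|\lambda|F(x,y)$ for all real $\lambda$. $F$ is projectively flat on the open set $U\subseteq\mathbb R^n$ if its geodesics are straight lines, equivalently $F_{x^ky^l}y^k-F_{x^l}=0$. An $(\alpha,\beta)$-metric is a Finsler metric of the form $F=\alpha\phi(\beta/\alpha)$, where $\alpha=\sqrt{a_{ij}(x)y^iy^j}$ is a Riemannian metric, $\beta=b_i(x)y^i$ is a 1-form, and $\phi$ is a positive smooth function on a symmetric interval $(-b_o,b_o)$, normalized by $\phi(0)=1$, with $b:=\|\beta\|_\alpha=\sqrt{a^{ij}b_ib_j}<b_o$, and $\phi(s)-s\phi'(s)+(b^2-s^2)\phi''(s)>0$ for all real $s,b$ with $|s|\le b<b_o$. The trivial case is the one where $\alpha$ is locally projectively flat and $\beta$ is parallel with respect to $\alpha$; a projectively flat $(\alpha,\beta)$-metric is non-trivial if it is not in the trivial case.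
   Formalization: Non-trivial is taken to mean that on no connected component of U is the metric in the trivial case; for connected U this is the stated notion, and for disconnected U the claim with only global non-triviality is false. *)

(* Defs.v *)
From mathcomp Require Import all_boot all_order all_algebra.
From mathcomp Require Import all_classical all_reals all_analysis.

Set Implicit Arguments.
Unset Strict Implicit.
Unset Printing Implicit Defensive.

Import Order.TTheory GRing.Theory Num.Theory.
Import numFieldNormedType.Exports.

Local Open Scope classical_set_scope.
Local Open Scope ring_scope.

(* Tensors on an open set A are total functions; only their values at points
   of A matter, and A is open whenever a derivative at a point of A is used. *)

Fixpoint Ck_on (R : realType) (V W : normedModType R) (k : nat) (A : set V)
    (f : V -> W) : Prop :=
  if k is k'.+1 then
    (forall x, A x -> differentiable f x) /\
    (forall v : V, Ck_on k' A ('D_v f))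
  else forall x, A x -> {for x, continuous f}.

Definition smooth_on (R : realType) (V W : normedModType R) (A : set V)
    (f : V -> W) : Prop :=
  forall k, Ck_on k A f.

Section Finsler.
Context {R : realType} {n : nat}.
Local Notation V := 'rV[R]_n.

Definition evec (i : 'I_n) : V := delta_mx 0 i.

Definition Dx (F : V -> V -> R) (k : 'I_n) : V -> V -> R :=
  fun x y => 'D_(evec k) (fun z : V => F z y : R^o) x.

Definition Dy (F : V -> V -> R) (l : 'I_n) : V -> V -> R :=
  fun x y => 'D_(evec l) (fun v : V => F x v : R^o) y.

Definition posdef (M : 'M[R]_n) : Prop :=
  forall v : V, v != 0 -> 0 < \sum_i \sum_j M i j * v 0 i * v 0 j.

Definition fundamental_tensor (F : V -> V -> R) (x y : V) : 'M[R]_n :=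
  \matrix_(i, j) Dy (Dy (fun z v => 2^-1 * F z v ^+ 2) i) j x y.

(* A point of TU is a pair (x, y) with x in U and y an arbitrary vector. *)
Record finsler_metric (U : set V) (F : V -> V -> R) : Prop := FinslerMetric {
  finsler_ge0 : forall x y, U x -> 0 <= F x y;
  finsler_continuous : forall p : V * V, U p.1 ->
    {for p, continuous (fun q : V * V => F q.1 q.2 : R^o)};
  finsler_smooth :
    smooth_on [set p : V * V | U p.1 /\ p.2 != 0]
              (fun q : V * V => F q.1 q.2 : R^o);
  finsler_homogeneous : forall x y (c : R), U x -> 0 < c ->
    F x (c *: y) = c * F x y;
  finsler_convex : forall x y, U x -> y != 0 ->
    posdef (fundamental_tensor F x y)
}.

Definition reversible (U : set V) (F : V -> V -> R) : Prop :=
  forall x y (c : R), U x -> F x (c *: y) = `|c| * F x y.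

(* Hamel's equation F_{x^k y^l} y^k - F_{x^l} = 0 on TU minus the zero
   section, which says that the geodesics are straight lines. *)
Definition projectively_flat (U : set V) (F : V -> V -> R) : Prop :=
  forall x y, U x -> y != 0 -> forall l : 'I_n,
    \sum_k Dy (Dx F k) l x y * y 0 k - Dx F l x y = 0.

(* Every point has a coordinate chart (with inverse psi, defined on the open
   set N') in which F is projectively flat; 'D_w psi u is the image of the
   tangent vector w at u under the differential of psi. *)
Definition locally_projectively_flat (U : set V) (F : V -> V -> R) : Prop :=
  forall x, U x ->
  exists (N N' : set V) (chi psi : V -> V),
    [/\ open N, open N', N x & N `<=` U] /\
    [/\ smooth_on N chi, smooth_on N' psi,
        (forall z, N z -> N' (chi z) /\ psi (chi z) = z),
        (forall u, N' u -> N (psi u) /\ chi (psi u) = u) &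
        projectively_flat N' (fun u w => F (psi u) ('D_w psi u))].

(* The matrix field a stands for (a_ij), the row-vector field b for (b_i). *)

Definition riemannian_metric (U : set V) (a : V -> 'M[R]_n) : Prop :=
  [/\ smooth_on U a,
      (forall x, U x -> (a x)^T = a x) &
      (forall x, U x -> posdef (a x))].

Definition alpha (a : V -> 'M[R]_n) (x y : V) : R :=
  Num.sqrt (\sum_i \sum_j a x i j * y 0 i * y 0 j).

Definition one_form (b : V -> V) (x y : V) : R := \sum_i b x 0 i * y 0 i.

Definition norm_form (a : V -> 'M[R]_n) (b : V -> V) (x : V) : R :=
  Num.sqrt (\sum_i \sum_j invmx (a x) i j * b x 0 i * b x 0 j).

Definition closed_form (U : set V) (b : V -> V) : Prop :=
  forall x, U x -> forall i j : 'I_n,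
    'D_(evec j) (fun z : V => b z 0 i : R^o) x =
    'D_(evec i) (fun z : V => b z 0 j : R^o) x.

Definition christoffel (a : V -> 'M[R]_n) (x : V) (k i j : 'I_n) : R :=
  2^-1 * \sum_l invmx (a x) k l *
    ('D_(evec i) (fun z : V => a z j l : R^o) x +
     'D_(evec j) (fun z : V => a z i l : R^o) x -
     'D_(evec l) (fun z : V => a z i j : R^o) x).

Definition parallel_form (U : set V) (a : V -> 'M[R]_n) (b : V -> V) : Prop :=
  forall x, U x -> forall i j : 'I_n,
    'D_(evec j) (fun z : V => b z 0 i : R^o) x -
    \sum_k christoffel a x k i j * b x 0 k = 0.

(* F = alpha phi(beta / alpha).  The bound bo may be +oo, i.e. phi may be
   defined on the whole line.  At y = 0 the quotient is 0 / 0 = 0, so that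
   ab_form gives F x 0 = 0 * phi 0 = 0, as it should. *)
Record ab_metric (U : set V) (a : V -> 'M[R]_n) (b : V -> V) (phi : R -> R)
    (bo : \bar R) (F : V -> V -> R) : Prop := ABMetric {
  ab_finsler : finsler_metric U F;
  ab_riemannian : riemannian_metric U a;
  ab_one_form : smooth_on U b;
  ab_bo : (0 < bo)%E;
  ab_phi_smooth : smooth_on [set s : R^o | (`|s|%:E < bo)%E]
                            (phi : R^o -> R^o);
  ab_phi_gt0 : forall s : R, (`|s|%:E < bo)%E -> 0 < phi s;
  ab_phi0 : phi 0 = 1;
  ab_phi_convex : forall s c : R, `|s| <= c -> (c%:E < bo)%E ->
    0 < phi s - s * derive1 phi s + (c ^+ 2 - s ^+ 2) * derive1n 2 phi s;
  ab_norm : forall x, U x -> ((norm_form a b x)%:E < bo)%E;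
  ab_form : forall x y, U x ->
    F x y = alpha a x y * phi (one_form b x y / alpha a x y)
}.

Definition trivial_case (U : set V) (a : V -> 'M[R]_n) (b : V -> V) : Prop :=
  locally_projectively_flat U (alpha a) /\ parallel_form U a b.

(* A metric on a disconnected open set is a family of unrelated metrics, one
   on each connected component; it is non-trivial when none of them is in the
   trivial case.  For connected U this is the negation of the trivial case,
   see nontrivial_connected. *)
Definition nontrivial (U : set V) (a : V -> 'M[R]_n) (b : V -> V) : Prop :=
  forall x, U x -> ~ trivial_case (connected_component U x) a b.

Lemma nontrivial_connected (U : set V) (a : V -> 'M[R]_n) (b : V -> V) :
  connected U -> U !=set0 -> nontrivial U a b <-> ~ trivial_case U a b.
Proof.
move=> cU [x Ux]; split=> [ntU tU | ntU z Uz].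
  by apply: (ntU x Ux); rewrite connected_component_id.
by rewrite connected_component_id.
Qed.

End Finsler.

(* Main.v *)
From HB Require Import structures.
Require Import Defs.
From mathcomp Require Import all_boot all_order all_algebra.
From mathcomp Require Import all_classical all_reals all_analysis.
From mathcomp Require Import perm ring lra.

Set Implicit Arguments.
Unset Strict Implicit.
Unset Printing Implicit Defensive.

Import Order.TTheory GRing.Theory Num.Theory.
Import numFieldNormedType.Exports.

Local Open Scope classical_set_scope.
Local Open Scope ring_scope.

(** Write [s = beta / alpha] and split [phi] into its even part and its odd part
    [h].  The claim is that [h] is linear on every slope that occurs, that is,
    [h s = phi' 0 * s] for [s^2 <= |beta|^2].  Then [theta = - phi' 0 * beta]
    cancels the odd part of [F], so that [G = F + theta] is
    [alpha * even_part phi (beta / alpha)]; it is also the mean of [F (x, y)] and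
    [F (x, - y)].  Everything asked of [G] follows: Hamel's equation is linear
    and invariant under [y -> - y]; the conditions on [phi] are linear
    inequalities invariant under reversal; and since [theta] is linear in [y],
    [G] has the same fibre Hessian as [F], which is what strong convexity depends
    on (posdef_fundamental_shift).  The form [theta] is closed because, being the
    difference of two solutions, it satisfies Hamel's equation itself.

    Linearity of [h] comes from the expansion (hamel_formula) of Hamel's
    operator on [alpha psi (s)], for any [psi], as
    [(psi - s psi') A + psi' C + psi'' rho S].  Here [A] is Hamel's operator on
    [alpha], [C] the exterior derivative of [beta] contracted with [y], [S] the
    fibre gradient of the slope and [rho] a scalar.  Under [y -> - y] the terms
    [A], [rho], [S] are even and [C] is odd, so the expression vanishes not only
    for [psi = phi] but also for [psi = h].  At a fixed point [x] this gives two
    linear equations with the same unknowns.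

    If [C] is not zero, contract with a vector orthogonal to [y] and in the
    kernel of [beta], on which [C] does not vanish; this needs dimension three.
    The term in [S] disappears, and the determinant of the remaining system
    gives [phi h' - phi' h = 0], so [h / phi] is constant, hence zero
    (curl_linear).  If [C] is zero, contract with the dual vector of [beta]
    instead: with [e = phi - s phi' > 0] and [eta = h - s h'], the system is
    degenerate as soon as the symmetric covariant derivative of [beta] is
    nonzero, so [e eta' - e' eta = 0], hence [eta] is zero and [h] is linear
    (sym_linear).  In both cases [y] runs through a plane containing the dual
    vector of [beta], where all slopes occur and where the nonvanishing
    condition fails for at most two directions (sweep_eq0).

    So at each point either [h] is linear on the range of slopes there or
    [beta] is parallel there.  Where [beta] is parallel its length is
    stationary, so the length cannot climb from the range where [h] is linear to
    the range where it is not; a point with a range of the second kind would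
    force [beta] to be parallel on its whole component (odd_part_linear).  There
    the expansion for [psi = phi] reduces to [A = 0], so [alpha] is projectively
    flat and the component is in the trivial case, which is excluded. *)

(** * Directional derivatives and smoothness *)

Section DirectionalCalculus.
Context {R : realType} {V : normedModType R}.
Implicit Types (f g : V -> R^o) (x v : V).

(** Directional derivatives are ordinary derivatives along a line, which is how
    the chain rule for real functions enters. *)
Lemma is_derive_line (W : normedModType R) (f : V -> W) x v df :
  is_derive (0 : R^o) (1 : R^o) (fun h : R^o => f (h *: v + x)) df <->
  is_derive x v f df.
Proof.
have E : 'D_(1 : R^o) (fun h : R^o => f (h *: v + x)) 0 = 'D_v f x.
  rewrite /derive; set g1 := fun h => _; set g2 := fun h => _.
  suff -> : g1 = g2 by [].
  apply/funext => h; rewrite /g1 /g2 /= addr0 scale0r add0r.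
  by rewrite [_%:A]mulr1.
split=> -[df1 df2].
  by split; [exact: (derivable1P f x v).2 | rewrite -E].
by split; [exact: (derivable1P f x v).1 | rewrite E].
Qed.

Lemma is_derive_comp_real f (phi : R^o -> R^o) x v (df dphi : R) :
  is_derive x v f df -> is_derive (f x : R^o) (1 : R^o) phi dphi ->
  is_derive x v (fun z => phi (f z) : R^o) (dphi * df).
Proof.
move=> /is_derive_line Df Dphi; apply/is_derive_line.
apply: (@is_derive1_comp R phi (fun h : R^o => f (h *: v + x))) => //.
by rewrite scale0r add0r.
Qed.

Lemma is_derive_addf f g x v (df dg : R) :
  is_derive x v f df -> is_derive x v g dg ->
  is_derive x v (fun z => f z + g z : R^o) (df + dg).
Proof. by move=> Df Dg; exact: is_deriveD. Qed.

Lemma is_derive_subf f g x v (df dg : R) :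
  is_derive x v f df -> is_derive x v g dg ->
  is_derive x v (fun z => f z - g z : R^o) (df - dg).
Proof. by move=> Df Dg; exact: is_deriveB. Qed.

Lemma is_derive_sumf n (h : 'I_n -> V -> R^o) (dh : 'I_n -> R) x v :
  (forall i, is_derive x v (h i) (dh i)) ->
  is_derive x v (fun z => \sum_i h i z : R^o) (\sum_i dh i).
Proof.
move=> Dh; have := is_derive_sum Dh.
suff -> : \sum_i h i = (fun z => \sum_i h i z : R^o) by [].
by apply/funext => z; rewrite fct_sumE.
Qed.

Lemma is_derive_mulf f g x v (df dg : R) :
  is_derive x v f df -> is_derive x v g dg ->
  is_derive x v (fun z => f z * g z : R^o) (df * g x + f x * dg).
Proof.
move=> Df Dg; refine (is_derive_eq (is_deriveM Df Dg) _).
by rewrite addrC /GRing.scale /= mulrC.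
Qed.

Lemma is_derive_divf f g x v (df dg : R) :
  is_derive x v f df -> is_derive x v g dg -> g x != 0 ->
  is_derive x v (fun z => f z / g z : R^o)
            ((df * g x - f x * dg) / g x ^+ 2).
Proof.
move=> Df [Dg dgE] gx.
have Dgi : is_derive x v (fun z => (g z)^-1 : R^o) (- (g x) ^- 2 * dg).
  by split; [exact: derivableV | rewrite deriveV // dgE].
by refine (is_derive_eq (is_derive_mulf Df Dgi) _); field.
Qed.

Lemma is_derive_sqrtf f x v (df : R) : is_derive x v f df -> 0 < f x ->
  is_derive x v (fun z => Num.sqrt (f z) : R^o) (df / (2 * Num.sqrt (f x))).
Proof.
move=> Df fx.
refine (is_derive_eq (is_derive_comp_real Df (is_derive1_sqrt fx)) _).
by rewrite mulrC.
Qed.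

Lemma is_derive_cstf (k : R) x v : is_derive x v (fun=> k : R^o) (0 : R).
Proof. exact: is_derive_cst. Qed.

End DirectionalCalculus.

Section Smooth.
Context {R : realType}.
Implicit Types V W : normedModType R.

(** Differentiability is local, like directional derivatives; by additivity the
    case of a function vanishing near the point is enough. *)
Lemma near0_differentiable V W (k : V -> W) (x : V) :
  (\near x, k x = 0) -> differentiable k x.
Proof.
move=> k0; have kx : k x = 0 by exact: nbhs_singleton k0.
apply/diffP => /=.
apply: (@getPex _ (fun (df : {linear V -> W}) => continuous df /\
  forall y, k y = k (lim (nbhs x)) + df (y - lim (nbhs x))
                  +o_(y \near x) (y - lim (nbhs x)))).
exists [the {linear V -> W} of \0]; split; first by move=> z; exact: cst_continuous.
apply: (eqaddoEx (h := k)) => y; rewrite littleoE.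
  by rewrite lim_id // kx /= addr0 add0r.
move=> e e0; near=> z; rewrite (near k0 z) // normr0.
by rewrite mulr_ge0 // ltW.
Unshelve. all: by end_near. Qed.

Lemma near_eq_differentiable V W (f g : V -> W) (x : V) :
  (\near x, f x = g x) -> differentiable f x -> differentiable g x.
Proof.
move=> fg df; rewrite (_ : g = f + (g - f)); last by rewrite addrC subrK.
apply: differentiableD => //; apply: near0_differentiable.
by apply: filterS fg => z; rewrite !fctE => ->; rewrite subrr.
Qed.

Lemma near_open V (A : set V) (P : V -> Prop) (x : V) : open A -> A x ->
  (forall z, A z -> P z) -> \near x, P x.
Proof. by move=> Ao Ax AP; apply: filterS AP _; exact: open_nbhs_nbhs. Qed.

Lemma open_nonzero V : open [set v : V | v != 0].
Proof.
rewrite (_ : [set v : V | v != 0] = ~` [set 0]).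
  apply/closed_openC/accessible_closed_set1/hausdorff_accessible.
  exact: norm_hausdorff.
by apply/seteqP; split=> v /= /eqP.
Qed.

(** Derivatives of order [k] on an open set only see the values on that set, so
    pointwise rules of differentiation valid on the set pass to [Ck_on]. *)
Lemma eq_Ck_on V W k (A : set V) (f g : V -> W) : open A ->
  (forall x, A x -> f x = g x) -> Ck_on k A f -> Ck_on k A g.
Proof.
move=> Ao; elim: k f g => [|k IH] f g fg /=.
  move=> Cf x Ax; have nfg : \near x, f x = g x by exact: near_open Ax fg.
  suff : g @ x --> g x by [].
  by rewrite -(fg x Ax); apply: cvg_trans (Cf x Ax); exact: near_eq_cvg.
move=> [df Cf]; split=> [x Ax|v].
  by apply: (near_eq_differentiable _ (df x Ax)); exact: near_open Ax fg.
apply: IH (Cf v) => x Ax; apply: near_eq_derive.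
exact: near_open Ax fg.
Qed.

Lemma Ck_on_cst V W k (A : set V) (w : W) : Ck_on k A (cst w).
Proof.
elim: k w => [|k IH] w /=; first by move=> x _; exact: cst_continuous.
split=> [x _|v]; first exact: differentiable_cst.
rewrite (_ : 'D_v _ = cst 0); first exact: IH.
by apply/funext => x; rewrite derive_cst.
Qed.

Lemma Ck_on_id V k (A : set V) : Ck_on k A (@id V).
Proof.
case: k => [|k] /=; first by move=> x _; exact: cvg_id.
split=> [x _|v] //.
rewrite (_ : 'D_v _ = cst v); first exact: Ck_on_cst.
by apply/funext => x; rewrite derive_id.
Qed.

Lemma Ck_onD V W k (A : set V) (f g : V -> W) : open A ->
  Ck_on k A f -> Ck_on k A g -> Ck_on k A (fun x => f x + g x).
Proof.
move=> Ao; elim: k f g => [|k IH] f g /=.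
  by move=> Cf Cg x Ax; apply: cvgD; [exact: Cf | exact: Cg].
move=> [df Cf] [dg Cg]; split=> [x Ax|v].
  by apply: differentiableD; [exact: df | exact: dg].
apply: eq_Ck_on (IH _ _ (Cf v) (Cg v)) => // x Ax.
by rewrite deriveD //; apply: diff_derivable; [exact: df | exact: dg].
Qed.

Lemma Ck_onZ V W k (A : set V) (c : R) (f : V -> W) : open A ->
  Ck_on k A f -> Ck_on k A (fun x => c *: f x).
Proof.
move=> Ao; elim: k f => [|k IH] f /=.
  by move=> Cf x Ax; apply: cvgZr; exact: Cf.
move=> [df Cf]; split=> [x Ax|v].
  by apply: differentiableZ; exact: df.
apply: eq_Ck_on (IH _ (Cf v)) => // x Ax.
by rewrite deriveZ //; apply: diff_derivable; exact: df.
Qed.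

Lemma derive_affine (V V' W : normedModType R) (f : V -> W) (g : V' -> V)
    (L : V' -> V) z v : scalable L -> (forall z h, g (h + z) = L h + g z) ->
  'D_v (fun z => f (g z)) z = 'D_(L v) f (g z).
Proof.
move=> ZL gL; rewrite /derive; set g1 := fun h => _; set g2 := fun h => _.
suff -> : g1 = g2 by [].
by apply/funext => h; rewrite /g1 /g2 /= gL ZL.
Qed.

(** Applied to the reflection [y -> - y] of the fibres, to the inclusion of a
    single fibre, and to [s -> - s]. *)
Lemma Ck_on_affine (V V' W : normedModType R) k (A : set V) (f : V -> W)
    (g : V' -> V) (L : V' -> V) :
  linear L -> continuous L -> (forall z h, g (h + z) = L h + g z) ->
  Ck_on k A f -> Ck_on k [set z | A (g z)] (fun z => f (g z)).
Proof.
move=> linL cL gL.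
pose L' : {linear V' -> V} :=
  HB.pack L (GRing.isLinear.Build R V' V *:%R L linL).
have gE : g = (L' : V' -> V) + cst (g 0).
  by apply/funext => z; rewrite !fctE -gL addr0.
have dg z : differentiable g z.
  by rewrite gE; apply: differentiableD => //; exact: linear_differentiable.
elim: k f => [|k IH] f /=.
  move=> Cf x Ax; apply: (@continuous_comp _ _ _ g f); last exact: Cf.
  exact: differentiable_continuous.
move=> [df Cf]; split=> [x Ax|v].
  by apply: (@differentiable_comp _ _ _ _ g f) => //; exact: df.
rewrite (_ : 'D_v _ = fun z => 'D_(L v) f (g z)); first exact: (IH _ (Cf (L v))).
apply/funext => z; apply: (@derive_affine V V' W f g L) => // c u.
by rewrite -[L _]/(L' _) -[L u]/(L' u) linearZ.
Qed.

End Smooth.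

(** * Real functions of one variable *)

Section RealLemmas.
Context {R : realType}.
Implicit Types (s t N : R).

Lemma is_derive_continuous_real (f : R^o -> R^o) (s df : R) :
  is_derive (s : R^o) (1 : R^o) f df -> {for s, continuous f}.
Proof. by move=> [/derivable1_diffP Df _]; exact: differentiable_continuous. Qed.

Lemma derive0_cst (f : R^o -> R^o) N :
  (forall s, s ^+ 2 < N -> is_derive (s : R^o) (1 : R^o) f (0 : R)) ->
  forall s, s ^+ 2 < N -> f s = f 0.
Proof.
move=> Df s sN.
have seg (a b : R) : a <= b -> a ^+ 2 < N -> b ^+ 2 < N -> f a = f b.
  move=> ab aN bN.
  have inN x : x \in `[a, b] -> x ^+ 2 < N.
    by rewrite in_itv /= => /andP[ax xb]; case: (lerP 0 x) => x0; nra.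
  have [z /subset_itv_oo_cc zab||c _] := @MVT_segment R f (fun=> 0) a b ab.
  - exact: Df (inN _ zab).
  - apply: continuous_in_subspaceT => x; rewrite inE /= => xab.
    exact: is_derive_continuous_real (Df x (inN x xab)).
  by rewrite mul0r => /eqP; rewrite subr_eq0 => /eqP ->.
have N0 : 0 ^+ 2 < N by rewrite expr0n /= (le_lt_trans (sqr_ge0 s)).
by case: (lerP 0 s) => s0; [symmetry; exact: seg | apply: seg => //; exact: ltW].
Qed.

(** The vanishing Wronskian says that [g / f] has derivative zero. *)
Lemma wronskian_eq0 (f f' g g' : R -> R) N :
  (forall s, s ^+ 2 < N -> is_derive (s : R^o) (1 : R^o) (f : R^o -> R^o) (f' s)) ->
  (forall s, s ^+ 2 < N -> is_derive (s : R^o) (1 : R^o) (g : R^o -> R^o) (g' s)) ->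
  (forall s, s ^+ 2 < N -> 0 < f s) ->
  (forall s, s ^+ 2 < N -> f s * g' s - f' s * g s = 0) ->
  g 0 = 0 -> forall s, s ^+ 2 < N -> g s = 0.
Proof.
move=> Df Dg f0 W g0 s sN.
have fn0 t : t ^+ 2 < N -> f t != 0 by move=> tN; rewrite gt_eqF ?f0.
suff : g s / f s = g 0 / f 0.
  rewrite g0 mul0r => /eqP; rewrite mulf_eq0 invr_eq0 (negbTE (fn0 s sN)).
  by rewrite orbF => /eqP.
apply: (@derive0_cst (fun s => g s / f s) N) => // t tN.
have Q : exists2 q, q = 0 & is_derive (t : R^o) (1 : R^o)
    (fun s : R^o => g s / f s : R^o) q.
  exists ((g' t * f t - g t * f' t) / f t ^+ 2).
    by rewrite -[RHS](mul0r (f t ^+ 2)^-1) -(W t tN); congr (_ / _); ring.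
  have Dfi : is_derive (t : R^o) (1 : R^o) (fun z => (f z)^-1 : R^o)
      (- (f t) ^- 2 * f' t).
    have [Df1 Df2] := Df t tN.
    by split; [exact: derivableV (fn0 t tN) Df1
              | rewrite (deriveV (fn0 t tN) Df1) Df2].
  refine (is_derive_eq (is_deriveM (Dg t tN) Dfi) _).
  by rewrite /GRing.scale /=; field; exact: fn0.
by case: Q => q ->.
Qed.

Lemma quad_zero3 (p0 p1 p2 t1 t2 t3 : R) : t1 < t2 -> t2 < t3 ->
  p0 + p1 * t1 + p2 * t1 ^+ 2 = 0 -> p0 + p1 * t2 + p2 * t2 ^+ 2 = 0 ->
  p0 + p1 * t3 + p2 * t3 ^+ 2 = 0 -> [/\ p0 = 0, p1 = 0 & p2 = 0].
Proof.
move=> t12 t23 e1 e2 e3.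
have f12 : p1 + p2 * (t1 + t2) = 0.
  apply: (mulfI (_ : t2 - t1 != 0)); first by rewrite subr_eq0 gt_eqF.
  by rewrite mulr0 -[RHS](subrr 0) -{1}e2 -e1; ring.
have f23 : p1 + p2 * (t2 + t3) = 0.
  apply: (mulfI (_ : t3 - t2 != 0)); first by rewrite subr_eq0 gt_eqF.
  by rewrite mulr0 -[RHS](subrr 0) -{1}e3 -e2; ring.
have p20 : p2 = 0.
  apply: (mulfI (_ : t3 - t1 != 0)).
    by rewrite subr_eq0 gt_eqF // (lt_trans t12).
  by rewrite mulr0 -[RHS](subrr 0) -{1}f23 -f12; ring.
have p10 : p1 = 0 by move: f12; rewrite p20 mul0r addr0.
by split=> //; move: e1; rewrite p10 p20 !mul0r !addr0.
Qed.

(** The zeros of a nonzero quadratic polynomial are isolated, so continuity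
    fills the gaps. *)
Lemma quad_mul_eq0 (K : R -> R) (p0 p1 p2 : R) : continuous (K : R^o -> R^o) ->
  (forall t, (p0 + p1 * t + p2 * t ^+ 2) * K t = 0) ->
  (p0, p1, p2) != (0, 0, 0) -> forall t, K t = 0.
Proof.
move=> cK pK /eqP pn0 t; apply/eqP; apply/negPn/negP => Kt.
have /nbhs_ballP[e /= e0 nK] : nbhs (t : R^o) [set z | K z != 0].
  exact: (cvgr_neq0 (K t) (cK t) Kt).
have e2 : 0 < e / 2 by lra.
have e3 : 0 < e / 3 by lra.
have pe r : 0 <= r -> r < e -> p0 + p1 * (t + r) + p2 * (t + r) ^+ 2 = 0.
  move=> r0 re; apply: (mulIf (nK (t + r) _)); last by rewrite mul0r pK.
  by rewrite /ball /= opprD addNKr normrN ger0_norm.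
have [] := @quad_zero3 p0 p1 p2 (t + 0) (t + e / 3) (t + e / 2).
- by lra.
- by lra.
- by apply: pe => //; lra.
- by apply: pe => //; lra.
- by apply: pe => //; lra.
by move=> p00 p10 p20; apply: pn0; rewrite p00 p10 p20.
Qed.

(** As [t] runs over the line, the point [t c + u] of a plane with orthogonal
    [c], [u] of square lengths [N], [q] has slope [t N / sqrt (t^2 N + q)], and
    all slopes of square less than [N] occur. *)
Lemma sweep_eq0 (k : R -> R) (p0 p1 p2 N q : R) : 0 < N -> 0 < q ->
  (forall s, s ^+ 2 < N -> {for s, continuous (k : R^o -> R^o)}) ->
  (forall t, (p0 + p1 * t + p2 * t ^+ 2) *
     k (t * N / Num.sqrt (t ^+ 2 * N + q)) = 0) ->
  (p0, p1, p2) != (0, 0, 0) -> forall s, s ^+ 2 < N -> k s = 0.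
Proof.
move=> N0 q0 ck pk pn0 s sN.
have D0 t : 0 < t ^+ 2 * N + q.
  by rewrite ltr_wpDl // mulr_ge0 ?sqr_ge0 // ltW.
have sN0 : 0 < N - s ^+ 2 by rewrite subr_gt0.
(* the solution of t N / sqrt (t^2 N + q) = s *)
pose t := s * Num.sqrt q / Num.sqrt (N * (N - s ^+ 2)).
have -> : s = t * N / Num.sqrt (t ^+ 2 * N + q).
  have -> : t ^+ 2 * N + q = q * N / (N - s ^+ 2).
    rewrite /t expr_div_n exprMn !sqr_sqrtr ?ltW ?mulr_gt0 //.
    by field; rewrite !gt_eqF.
  rewrite !sqrtrM ?ltW ?mulr_gt0 // sqrtrV ?ltW //.
  transitivity (s * (N / Num.sqrt N ^+ 2)).
    by rewrite sqr_sqrtr ?ltW // divff ?mulr1 // gt_eqF.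
  rewrite /t sqrtrM ?ltW //.
  by field; rewrite !gt_eqF ?sqrtr_gt0.
apply: (@quad_mul_eq0 (fun t => k (t * N / Num.sqrt (t ^+ 2 * N + q))) p0 p1 p2)
  => // {}t.
apply: (@continuous_comp _ _ _
  (fun t : R^o => t * N / Num.sqrt (t ^+ 2 * N + q) : R^o) k).
  apply: cvgM.
    by apply: cvgM; [exact: cvg_id | exact: cvg_cst].
  apply: cvgV; first by rewrite gt_eqF ?sqrtr_gt0.
  apply: (@continuous_comp _ _ _ (fun t : R^o => t ^+ 2 * N + q : R^o) Num.sqrt);
    last exact: sqrt_continuous.
  apply: cvgD; last exact: cvg_cst.
  by apply: cvgM; [exact: exprn_continuous | exact: cvg_cst].
apply: ck; rewrite expr_div_n exprMn sqr_sqrtr ?ltW //.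
rewrite ltr_pdivrMr // -subr_gt0.
have -> : N * (t ^+ 2 * N + q) - t ^+ 2 * N ^+ 2 = N * q by ring.
by rewrite mulr_gt0.
Qed.

End RealLemmas.

(** * Scalar products of row vectors *)

Section LinearAlgebra.
Context {R : realType} {n : nat}.
Implicit Types (u v w y : 'rV[R]_n) (M : 'M[R]_n).

Definition dot u v : R := \sum_i u 0 i * v 0 i.

Lemma dotE u v : dot u v = (u *m v^T) 0 0.
Proof. by rewrite mxE; apply: eq_bigr => i _; rewrite mxE. Qed.

Lemma dotC u v : dot u v = dot v u.
Proof. by apply: eq_bigr => i _; rewrite mulrC. Qed.

Lemma dotDl u v w : dot (u + v) w = dot u w + dot v w.
Proof. by rewrite !dotE mulmxDl mxE. Qed.

Lemma dotNl u w : dot (- u) w = - dot u w.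
Proof. by rewrite !dotE mulNmx mxE. Qed.

Lemma dotZl k u w : dot (k *: u) w = k * dot u w.
Proof. by rewrite !dotE -scalemxAl mxE. Qed.

Lemma dotDr u v w : dot w (u + v) = dot w u + dot w v.
Proof. by rewrite ![dot w _]dotC dotDl. Qed.

Lemma dotNr u w : dot w (- u) = - dot w u.
Proof. by rewrite ![dot w _]dotC dotNl. Qed.

Lemma dotZr k u w : dot w (k *: u) = k * dot w u.
Proof. by rewrite ![dot w _]dotC dotZl. Qed.

Lemma dot0l w : dot 0 w = 0.
Proof. by rewrite dotE mul0mx mxE. Qed.

Lemma dot0r w : dot w 0 = 0.
Proof. by rewrite dotC dot0l. Qed.

Definition dotL := (dotDl, dotDr, dotNl, dotNr, dotZl, dotZr).

Lemma dot_evec u i : dot u (evec i) = u 0 i.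
Proof.
rewrite /dot (bigD1 i) //= big1 => [|j ji]; rewrite !mxE ?eqxx.
  by rewrite mulr1 addr0.
by rewrite (negbTE ji) mulr0.
Qed.

Lemma row_evec u : u = \sum_i u 0 i *: evec i.
Proof. exact: row_sum_delta. Qed.

Lemma dot_quad M u v : \sum_i \sum_j M i j * u 0 i * v 0 j = dot (u *m M) v.
Proof.
rewrite exchange_big /=; apply: eq_bigr => j _.
by rewrite mxE mulr_suml; apply: eq_bigr => i _; rewrite (mulrC (M i j)).
Qed.

Lemma dot_trmx M u v : dot (u *m M) v = dot (v *m M^T) u.
Proof. by rewrite [RHS]dotC dotE [RHS]dotE trmx_mul trmxK mulmxA. Qed.

Lemma posdefE M : posdef M <-> forall v, v != 0 -> 0 < dot (v *m M) v.
Proof. by split=> pM v /pM; rewrite dot_quad. Qed.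

Lemma posdef_unitmx M : posdef M -> M \in unitmx.
Proof.
move=> /posdefE pM; rewrite -row_free_unit -kermx_eq0; apply/rowV0P => v.
rewrite sub_kermx => /eqP vM; apply/eqP/negPn/negP => /pM.
by rewrite vM dot0l ltxx.
Qed.

(** This is the only use of dimension at least three. *)
Lemma exists_orthogonal2 u v : (3 <= n)%N ->
  exists2 w, w != 0 & dot w u = 0 /\ dot w v = 0.
Proof.
move=> n3; pose K := row_mx u^T v^T : 'M[R]_(n, 1 + 1).
have : kermx K != 0.
  rewrite -mxrank_eq0 mxrank_ker subn_eq0 -ltnNge.
  by rewrite (leq_ltn_trans (rank_leq_col K)).
move=> /rowV0Pn[w]; rewrite sub_kermx mul_mx_row => /eqP wK w0.
exists w => //; rewrite !dotE.
have := row_mx0 R 1 1 1; rewrite -wK => /eq_row_mx[<- <-].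
by rewrite !mxE.
Qed.

End LinearAlgebra.

Definition odd_part (R : realType) (f : R -> R) (s : R) : R :=
  2^-1 * (f s - f (- s)).
Definition even_part (R : realType) (f : R -> R) (s : R) : R :=
  2^-1 * (f s + f (- s)).

(** * Hamel's operator at one point *)

(** All terms of Hamel's operator at a point [x] are algebraic in the first jets
    of [alpha] and [beta]: [M] and [b] are the values of the metric and of the
    form, [dA k] and [dB k] their derivatives along the [k]-th coordinate. *)
Section Point.
Context {R : realType} {n : nat}.
Variables (M : 'M[R]_n) (b : 'rV[R]_n) (dA : 'I_n -> 'M[R]_n)
  (dB : 'I_n -> 'rV[R]_n).
Implicit Types (u v w y : 'rV[R]_n).

Definition len y : R := Num.sqrt (dot (y *m M) y).

Definition slope y : R := dot b y / len y.

(** The geodesic coefficients of the metric with lowered index: the Christoffel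
    symbols of the first kind evaluated at [(y, y)]. *)
Definition spray y : 'rV[R]_n :=
  \row_l (\sum_k (y *m dA k) 0 l * y 0 k - 2^-1 * dot (y *m dA l) y).

(** The derivative of [alpha^2] along [y] in the base. *)
Definition dquad y : R := \sum_k y 0 k * dot (y *m dA k) y.

(** The derivative of [beta] along [y] in the base. *)
Definition dform y : R := \sum_k y 0 k * dot (dB k) y.

(** The exterior derivative of [beta] contracted with [y]; this is also Hamel's
    operator on [beta]. *)
Definition curl y : 'rV[R]_n := \row_l (\sum_k dB k 0 l * y 0 k - dot (dB l) y).

(** Hamel's operator on [alpha]. *)
Definition hamel_len y : 'rV[R]_n :=
  (len y)^-1 *: spray y - (dquad y / (2 * len y ^+ 3)) *: (y *m M).

(** The gradient of the slope along the fibre. *)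
Definition dslope y : 'rV[R]_n :=
  (len y)^-1 *: (b - (slope y / len y) *: (y *m M)).

(** [alpha] times the derivative of the slope along [y] in the base. *)
Definition slope_rate y : R := dform y - slope y * dquad y / (2 * len y).

(** Hamel's operator on [alpha psi (beta / alpha)]; [psi1] and [psi2] stand for
    the first two derivatives of [psi]. *)
Definition hamel_row (psi psi1 psi2 : R -> R) y : 'rV[R]_n :=
  (psi (slope y) - slope y * psi1 (slope y)) *: hamel_len y +
  psi1 (slope y) *: curl y + (psi2 (slope y) * slope_rate y) *: dslope y.

Lemma lenN y : len (- y) = len y.
Proof. by rewrite /len mulNmx !dotL opprK. Qed.

Lemma slopeN y : slope (- y) = - slope y.
Proof. by rewrite /slope lenN !dotL mulNr. Qed.

Lemma sprayN y : spray (- y) = spray y.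
Proof.
apply/rowP => l; rewrite !mxE mulNmx !dotL opprK; congr (_ - _).
by apply: eq_bigr => k _; rewrite !mulNmx ![(- _ : 'rV__) 0 _]mxE mulrNN.
Qed.

Lemma dquadN y : dquad (- y) = - dquad y.
Proof.
rewrite /dquad -sumrN; apply: eq_bigr => k _.
by rewrite mulNmx !dotL opprK mxE mulNr.
Qed.

Lemma dformN y : dform (- y) = dform y.
Proof. by rewrite /dform; apply: eq_bigr => k _; rewrite !dotL mxE mulrNN. Qed.

Lemma curlE y w : dot (curl y) w =
  \sum_k y 0 k * dot (dB k) w - \sum_k w 0 k * dot (dB k) y.
Proof.
rewrite /dot; under eq_bigr => l _ do rewrite mxE mulrBl.
rewrite sumrB; congr (_ - _); last by apply: eq_bigr => l _; rewrite mulrC.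
under eq_bigr => l _ do rewrite mulr_suml.
rewrite exchange_big; apply: eq_bigr => k _ /=; rewrite mulr_sumr.
by apply: eq_bigr => l _; rewrite mulrCA mulrA.
Qed.

Lemma curl_anti y w : dot (curl y) w = - dot (curl w) y.
Proof. by rewrite !curlE opprB. Qed.

Lemma curl_self y : dot (curl y) y = 0.
Proof. by rewrite curlE subrr. Qed.

Lemma curlN y : curl (- y) = - curl y.
Proof.
apply/rowP => l; rewrite !mxE !dotL opprB opprK addrC; congr (_ + _).
by rewrite -sumrN; apply: eq_bigr => k _; rewrite mxE mulrN.
Qed.

Lemma curlD y w : curl (y + w) = curl y + curl w.
Proof.
apply/rowP => l; rewrite !mxE !dotL addrACA -opprD; congr (_ - _).
by rewrite -big_split; apply: eq_bigr => k _; rewrite mxE mulrDr.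
Qed.

Lemma curlZ t y : curl (t *: y) = t *: curl y.
Proof.
apply/rowP => l; rewrite !mxE !dotL mulrBr; congr (_ - _).
by rewrite mulr_sumr; apply: eq_bigr => k _; rewrite mxE mulrCA.
Qed.

Lemma hamel_lenN y : hamel_len (- y) = hamel_len y.
Proof. by rewrite /hamel_len lenN sprayN dquadN mulNmx mulNr scaleNr scalerN opprK. Qed.

Lemma dslopeN y : dslope (- y) = dslope y.
Proof. by rewrite /dslope lenN slopeN mulNmx mulNr scaleNr scalerN opprK. Qed.

Lemma slope_rateN y : slope_rate (- y) = slope_rate y.
Proof. by rewrite /slope_rate lenN slopeN dquadN dformN mulrNN. Qed.

(** The contraction [curl] is odd in [y] and the three other ingredients are
    even, so that reversing [y] in the expression for [psi] amounts to reversing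
    the argument of [psi]. *)
Lemma hamel_row_odd (psi psi1 psi2 : R -> R) y :
  hamel_row (odd_part psi) (even_part psi1) (odd_part psi2) y =
  2^-1 *: (hamel_row psi psi1 psi2 y - hamel_row psi psi1 psi2 (- y)).
Proof.
rewrite /hamel_row hamel_lenN dslopeN slope_rateN curlN slopeN.
apply/rowP => l; rewrite !mxE /odd_part /even_part.
by ring.
Qed.

Lemma hamel_row_even (psi psi1 psi2 : R -> R) y :
  hamel_row (even_part psi) (odd_part psi1) (even_part psi2) y =
  2^-1 *: (hamel_row psi psi1 psi2 y + hamel_row psi psi1 psi2 (- y)).
Proof.
rewrite /hamel_row hamel_lenN dslopeN slope_rateN curlN slopeN.
apply/rowP => l; rewrite !mxE /odd_part /even_part.
by ring.
Qed.

End Point.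

Section Pointwise.
Context {R : realType} {n : nat}.
Variables (M : 'M[R]_n) (b : 'rV[R]_n) (dA : 'I_n -> 'M[R]_n)
  (dB : 'I_n -> 'rV[R]_n) (P : 'M[R]_n).
Hypotheses (Msym : M^T = M) (Mpos : posdef M).
Implicit Types (u v w y : 'rV[R]_n) (s t : R).

Local Notation len := (len M).
Local Notation slope := (slope M b).
Local Notation hamel_row := (hamel_row M b dA dB).

Definition dual_vec : 'rV[R]_n := b *m invmx M.
Local Notation c := dual_vec.
Definition sqnorm : R := dot c b.
Local Notation N := sqnorm.

Lemma dual_vecK : c *m M = b.
Proof. by rewrite /dual_vec mulmxKV // posdef_unitmx. Qed.

Lemma dot_symM u v : dot (u *m M) v = dot (v *m M) u.
Proof. by rewrite dot_trmx Msym. Qed.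

Lemma dot_dual y : dot (y *m M) c = dot b y.
Proof. by rewrite dot_symM dual_vecK. Qed.

Lemma quad_ge0 y : 0 <= dot (y *m M) y.
Proof.
have [->|y0] := eqVneq y 0; first by rewrite dot0r.
by rewrite ltW // (posdefE M).1.
Qed.

Lemma quad_gt0 y : y != 0 -> 0 < dot (y *m M) y.
Proof. exact: (posdefE M).1. Qed.

Lemma len_gt0 y : y != 0 -> 0 < len y.
Proof. by move=> y0; rewrite sqrtr_gt0 quad_gt0. Qed.

Lemma len_sqr y : len y ^+ 2 = dot (y *m M) y.
Proof. by rewrite sqr_sqrtr // quad_ge0. Qed.

Lemma sqnormE : N = dot (c *m M) c.
Proof. by rewrite dual_vecK dotC. Qed.

Lemma sqnorm_ge0 : 0 <= N.
Proof. by rewrite sqnormE quad_ge0. Qed.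

(** The Cauchy-Schwarz inequality, from the sign of the form at the component of
    the dual vector orthogonal to [y]. *)
Lemma slope_sqr_le y : y != 0 -> slope y ^+ 2 <= N.
Proof.
move=> y0; rewrite expr_div_n len_sqr ler_pdivrMr ?quad_gt0 //.
set Q := dot (y *m M) y; have Q0 : 0 < Q by exact: quad_gt0.
have := quad_ge0 (Q *: c - dot b y *: y).
rewrite mulmxBl -!scalemxAl !dotL dual_vecK dot_dual (dotC b c) -/N -/Q.
set B := dot b y => h; rewrite -subr_ge0 -(pmulr_rge0 _ Q0).
by apply: le_trans h _; rewrite le_eqVlt; apply/orP; left; apply/eqP; ring.
Qed.

Lemma dslope_dot y w :
  dot (dslope M b y) w = (dot b w - slope y / len y * dot (y *m M) w) / len y.
Proof. by rewrite /dslope !dotL mulrC. Qed.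

Lemma dslope_dual y : y != 0 ->
  dot (dslope M b y) c = (N - slope y ^+ 2) / len y.
Proof.
move=> y0; rewrite dslope_dot dot_dual (dotC b c) -/N /slope.
by field; rewrite gt_eqF ?len_gt0.
Qed.

Lemma hamel_row_dot psi psi1 psi2 y w : dot (hamel_row psi psi1 psi2 y) w =
  (psi (slope y) - slope y * psi1 (slope y)) * dot (hamel_len M dA y) w +
  psi1 (slope y) * dot (curl dB y) w +
  psi2 (slope y) * slope_rate M b dA dB y * dot (dslope M b y) w.
Proof. by rewrite /hamel_row !dotL. Qed.

Lemma slope_plane t u : dot (c *m M) u = 0 ->
  slope (t *: c + u) = t * N / Num.sqrt (t ^+ 2 * N + dot (u *m M) u).
Proof.
move=> cu; have bu : dot b u = 0 by rewrite -dual_vecK.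
have qE : dot ((t *: c + u) *m M) (t *: c + u) = t ^+ 2 * N + dot (u *m M) u.
  rewrite mulmxDl -scalemxAl !dotL -sqnormE cu (dot_symM u c) cu.
  by ring.
by rewrite /slope /len qE !dotL (dotC b c) bu addr0.
Qed.

Lemma plane_neq0 t u : u != 0 -> dot (c *m M) u = 0 -> t *: c + u != 0.
Proof.
move=> u0 cu; apply/negP => /eqP E.
have uE : u = - (t *: c) by apply/eqP; rewrite -addr_eq0 addrC E.
have := quad_gt0 u0.
by rewrite {1}uE mulNmx -scalemxAl !dotL cu mulr0 oppr0 ltxx.
Qed.

(** [P] stands for the covariant derivative of [b], of which only the quadratic
    form enters Hamel's operator. *)
Hypothesis PE : forall y, dot (y *m P) y = dform dB y - dot (spray dA y) c.

(** The covariant derivative is tied to the coordinate expressions [slope_rate]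
    and [hamel_len] in this way because both are built from the spray. *)
Lemma slope_rateE y : y != 0 ->
  slope_rate M b dA dB y = dot (y *m P) y + len y * dot (hamel_len M dA y) c.
Proof.
move=> y0; rewrite PE /hamel_len /slope_rate !dotL dot_dual /slope.
by field; rewrite gt_eqF ?len_gt0.
Qed.

(** Where [b] is parallel, [slope_rate] is the length times the contraction [X]
    of [hamel_len] with the dual vector.  Contracting the whole equation with that
    vector gives [X] times the convexity expression of [psi], so [X = 0]; what
    remains is a positive multiple of [hamel_len]. *)
Lemma parallel_hamel_len (psi psi1 psi2 : R -> R) y : y != 0 ->
  (forall y, curl dB y = 0) -> (forall y, dot (y *m P) y = 0) ->
  (forall s, s ^+ 2 <= N -> 0 < psi s - s * psi1 s) ->
  (forall s, s ^+ 2 <= N -> 0 < psi s - s * psi1 s + (N - s ^+ 2) * psi2 s) ->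
  hamel_row psi psi1 psi2 y = 0 -> hamel_len M dA y = 0.
Proof.
move=> y0 C0 P0 e0 f0 H; have sN := slope_sqr_le y0.
have := congr1 (dot^~ c) H; rewrite hamel_row_dot C0 !dot0l dslope_dual //.
rewrite slope_rateE // P0 add0r mulr0 addr0.
set X := dot (hamel_len M dA y) c => HX.
have X0 : X = 0.
  apply: (mulIf (lt0r_neq0 (f0 _ sN))); rewrite mul0r -[RHS]HX.
  by field; rewrite gt_eqF ?len_gt0.
move: H; rewrite /hamel_row C0 scaler0 addr0 slope_rateE // P0 -/X X0.
rewrite mulr0 addr0 mulr0 scale0r addr0 => /eqP; rewrite scaler_eq0.
by rewrite gt_eqF ?e0 //= => /eqP.
Qed.

(** * The odd part of phi is linear where beta is not parallel *)

Section Linear.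
Variables (phi phi1 phi2 : R -> R).
Hypothesis n3 : (3 <= n)%N.
Hypothesis Dphi : forall s, s ^+ 2 < N ->
  is_derive (s : R^o) (1 : R^o) (phi : R^o -> R^o) (phi1 s).
Hypothesis Dphi1 : forall s, s ^+ 2 < N ->
  is_derive (s : R^o) (1 : R^o) (phi1 : R^o -> R^o) (phi2 s).
Hypothesis Cphi2 : forall s, s ^+ 2 < N ->
  {for s, continuous (phi2 : R^o -> R^o)}.
Hypothesis phi_gt0 : forall s, s ^+ 2 < N -> 0 < phi s.
Hypothesis phi_conv : forall s, s ^+ 2 < N -> 0 < phi s - s * phi1 s.
Hypothesis hamel_phi : forall y, y != 0 -> hamel_row phi phi1 phi2 y = 0.

Local Notation h := (odd_part phi).
Local Notation h1 := (even_part phi1).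
Local Notation h2 := (odd_part phi2).

Lemma is_derive_odd_part (f f' : R -> R) s :
  is_derive (s : R^o) (1 : R^o) (f : R^o -> R^o) (f' s) ->
  is_derive (- s : R^o) (1 : R^o) (f : R^o -> R^o) (f' (- s)) ->
  is_derive (s : R^o) (1 : R^o) (odd_part f : R^o -> R^o) (even_part f' s).
Proof.
move=> Ds Dn.
have DN : is_derive (s : R^o) (1 : R^o) (fun t : R^o => f (- t) : R^o) (f' (- s) * -1).
  exact: (@is_derive1_comp R f -%R).
refine (is_derive_eq (is_deriveZ 2^-1 (is_deriveB Ds DN)) _).
by rewrite /even_part /GRing.scale /=; ring.
Qed.

Lemma is_derive_even_part (f f' : R -> R) s :
  is_derive (s : R^o) (1 : R^o) (f : R^o -> R^o) (f' s) ->
  is_derive (- s : R^o) (1 : R^o) (f : R^o -> R^o) (f' (- s)) ->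
  is_derive (s : R^o) (1 : R^o) (even_part f : R^o -> R^o) (odd_part f' s).
Proof.
move=> Ds Dn.
have DN : is_derive (s : R^o) (1 : R^o) (fun t : R^o => f (- t) : R^o) (f' (- s) * -1).
  exact: (@is_derive1_comp R f -%R).
refine (is_derive_eq (is_deriveZ 2^-1 (is_deriveD Ds DN)) _).
by rewrite /odd_part /GRing.scale /=; ring.
Qed.

Let Dh s : s ^+ 2 < N ->
  is_derive (s : R^o) (1 : R^o) (h : R^o -> R^o) (h1 s).
Proof. by move=> sN; apply: is_derive_odd_part; apply: Dphi; rewrite ?sqrrN. Qed.

Let Dh1 s : s ^+ 2 < N ->
  is_derive (s : R^o) (1 : R^o) (h1 : R^o -> R^o) (h2 s).
Proof. by move=> sN; apply: is_derive_even_part; apply: Dphi1; rewrite ?sqrrN. Qed.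

Let Ch2 s : s ^+ 2 < N -> {for s, continuous (h2 : R^o -> R^o)}.
Proof.
move=> sN; apply: cvgM; first exact: cvg_cst.
apply: cvgB; first exact: Cphi2.
apply: (@continuous_comp _ _ _ (-%R : R^o -> R^o) phi2); first exact: opp_continuous.
by apply: Cphi2; rewrite sqrrN.
Qed.

Let hamel_h y : y != 0 -> hamel_row h h1 h2 y = 0.
Proof.
move=> y0; rewrite hamel_row_odd !hamel_phi ?oppr_eq0 //.
by rewrite subr0 scaler0.
Qed.

Let h00 : h 0 = 0.
Proof. by rewrite /odd_part oppr0 subrr mulr0. Qed.

Let h10 : h1 0 = phi1 0.
Proof. by rewrite /even_part oppr0; field. Qed.

(** For [w] orthogonal to [y] and in the kernel of [b], the equations for [phi]
    and for its odd part [h] involve only the contractions of [hamel_len] and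
    [curl] with [w].  Where [curl] contracts to something nonzero, the determinant
    [phi h' - phi' h] vanishes. *)
Lemma curl_linear y0 w0 : dot (curl dB y0) w0 != 0 ->
  forall s, s ^+ 2 < N -> h s = phi1 0 * s.
Proof.
move=> Cyw s sN; have N0 : 0 < N by rewrite (le_lt_trans (sqr_ge0 s)).
pose k s := phi s * h1 s - phi1 s * h s.
suff k0 : forall s, s ^+ 2 < N -> k s = 0.
  have h0 : forall s, s ^+ 2 < N -> h s = 0.
    by apply: (wronskian_eq0 Dphi Dh).
  have := k0 0; rewrite expr0n => /(_ N0) /eqP.
  rewrite /k h00 mulr0 subr0 mulf_eq0 h10 gt_eqF ?phi_gt0 ?expr0n //=.
  by move=> /eqP ->; rewrite h0 // mul0r.
move=> {}s {}sN.
(* a vector w killed by the form b but not by its exterior derivative *)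
have [w bw [v Cvw]] : exists2 w, dot b w = 0 & exists v, dot (curl dB v) w != 0.
  pose f y := y - (dot b y / N) *: c.
  have bf y : dot b (f y) = 0.
    by rewrite /f !dotL (dotC b c) -/N divfK ?subrr // gt_eqF.
  have fE y : y = f y + (dot b y / N) *: c by rewrite subrK.
  case: (eqVneq (dot (curl dB y0) (f w0)) 0) => [Z1|]; last first.
    by exists (f w0) => //; exists y0.
  exists (f y0) => //; exists c; apply: contraNneq Cyw => Z2.
  rewrite (fE w0) dotDr Z1 add0r dotZr {1}(fE y0) curlD curlZ !dotL curl_self.
  by rewrite curl_anti Z2 oppr0 !mulr0 addr0 mulr0.
have w0n : w != 0 by apply: contraNneq Cvw => ->; rewrite dot0r.
have cw : dot (c *m M) w = 0 by rewrite dual_vecK.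
(* an orthogonal direction u such that the plane of c and u is not in the
   kernel of the exterior derivative contracted with w *)
have [u u0 [cu wu Cu]] : exists2 u, u != 0 &
    [/\ dot (c *m M) u = 0, dot (w *m M) u = 0 &
     (dot (curl dB u) w, dot (curl dB c) w, 0 : R) != (0, 0, 0)].
  case: (eqVneq (dot (curl dB c) w) 0) => [Z|Z]; last first.
    have [u u0 [E1 E2]] := exists_orthogonal2 (c *m M) (w *m M) n3.
    exists u => //; rewrite dotC E1 dotC E2; split=> //.
    by apply: contraNneq Z => -[_ ->].
  have qw := quad_gt0 w0n.
  pose u := v - (dot (c *m M) v / N) *: c - (dot (w *m M) v / dot (w *m M) w) *: w.
  have CE : dot (curl dB u) w = dot (curl dB v) w.
    rewrite [RHS](_ : _ = dot (curl dB (u + (dot (c *m M) v / N) *: c +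
      (dot (w *m M) v / dot (w *m M) w) *: w)) w).
      by rewrite !(curlD, curlZ) !dotL Z curl_self !mulr0 !addr0.
    by congr (dot (curl dB _) w); rewrite /u addrAC !subrK.
  exists u.
    by apply: contraNneq Cvw; rewrite -CE => ->; rewrite curl_anti dot0r oppr0.
  split; last by rewrite CE; apply: contraNneq Cvw => -[->].
    rewrite /u !dotL cw mulr0 subr0 -sqnormE divfK ?subrr // gt_eqF //.
  rewrite /u !dotL (dot_symM w c) cw mulr0 subr0 divfK ?subrr // gt_eqF //.
apply: (@sweep_eq0 R k _ _ _ N (dot (u *m M) u) N0 (quad_gt0 u0) _ _ Cu s sN).
  move=> {}s {}sN; rewrite /k; apply: cvgB; apply: cvgM.
  - exact: is_derive_continuous_real (Dphi sN).
  - exact: is_derive_continuous_real (Dh1 sN).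
  - exact: is_derive_continuous_real (Dphi1 sN).
  - exact: is_derive_continuous_real (Dh sN).
move=> t; rewrite mul0r addr0 -slope_plane //; set y := t *: c + u.
have y0n : y != 0 by exact: plane_neq0.
have Z : dot (dslope M b y) w = 0.
  rewrite dslope_dot bw /y mulmxDl -scalemxAl !dotL cw (dot_symM u w) wu.
  by rewrite mulr0 addr0 mulr0 subrr mul0r.
have -> : dot (curl dB u) w + dot (curl dB c) w * t = dot (curl dB y) w.
  by rewrite /y curlD curlZ !dotL; ring.
have := congr1 (dot^~ w) (hamel_phi y0n); have := congr1 (dot^~ w) (hamel_h y0n).
rewrite !hamel_row_dot !dot0l Z !mulr0 !addr0 /k.
set X := dot _ w; set Y := dot _ w => E1 E2.
transitivity ((phi (slope y) - slope y * phi1 (slope y)) * 0 -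
  (h (slope y) - slope y * h1 (slope y)) * 0); last by ring.
by rewrite -{1}E1 -E2; ring.
Qed.

(** Contraction with the dual vector gives two equations in two unknowns, one of
    which is [slope_rate]; both unknowns can vanish only where the covariant
    derivative does.  Their determinant is, up to the factor [- s], the Wronskian
    of [phi - s phi'] and [h - s h']. *)
Lemma sym_linear y0 : (forall y, curl dB y = 0) -> dot (y0 *m P) y0 != 0 ->
  forall s, s ^+ 2 < N -> h s = phi1 0 * s.
Proof.
move=> C0 Py s sN; have N0 : 0 < N by rewrite (le_lt_trans (sqr_ge0 s)).
pose e s := phi s - s * phi1 s; pose eta s := h s - s * h1 s.
pose k s := e s * h2 s - phi2 s * eta s.
have Did f f1 f2 (Df : forall s, s ^+ 2 < N ->
    is_derive (s : R^o) (1 : R^o) (f : R^o -> R^o) (f1 s))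
    (Df1 : forall s, s ^+ 2 < N ->
    is_derive (s : R^o) (1 : R^o) (f1 : R^o -> R^o) (f2 s)) r : r ^+ 2 < N ->
    is_derive (r : R^o) (1 : R^o) (fun s : R^o => f s - s * f1 s : R^o)
      (- r * f2 r).
  move=> rN; refine (is_derive_eq (is_deriveB (Df r rN)
    (is_deriveM (is_derive_id _ _) (Df1 r rN))) _).
  by rewrite /GRing.scale /=; ring.
suff k0 : forall s, s ^+ 2 < N -> k s = 0.
  have eta0 : forall s, s ^+ 2 < N -> eta s = 0.
    apply: (wronskian_eq0 (Did _ _ _ Dphi Dphi1) (Did _ _ _ Dh Dh1)) => //.
      move=> {}s {}sN; transitivity (- s * k s); first by rewrite /k /e /eta; ring.
      by rewrite k0 // mulr0.
    by rewrite h00 mul0r subrr.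
  have h20 r : r ^+ 2 < N -> h2 r = 0.
    move=> rN; have := k0 r rN; rewrite /k eta0 // mulr0 subr0 => /eqP.
    by rewrite mulf_eq0 gt_eqF ?phi_conv //= => /eqP.
  have h1c : h1 s = h1 0.
    by apply: (@derive0_cst R h1 N) => // r rN; rewrite -(h20 r rN); exact: Dh1.
  by have /eqP := eta0 s sN; rewrite /eta subr_eq0 h1c h10 mulrC => /eqP.
move=> {}s {}sN.
have [u u0 [cu Pu]] : exists2 u, u != 0 & dot (c *m M) u = 0 /\
   (dot (u *m P) u, dot (c *m P) u + dot (u *m P) c, dot (c *m P) c)
     != (0, 0, 0).
  have [r [u [y0E cu]]] : exists r u, y0 = u + r *: c /\ dot (c *m M) u = 0.
    exists (dot (c *m M) y0 / N), (y0 - (dot (c *m M) y0 / N) *: c).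
    by rewrite subrK !dotL -sqnormE divfK ?subrr // gt_eqF.
  have [uE|u0] := eqVneq u 0; last first.
    exists u => //; split=> //.
    apply: contraNneq Py => -[Z1 Z2 Z3].
    apply/eqP; rewrite y0E mulmxDl -scalemxAl !dotL.
    transitivity (dot (u *m P) u + r * (dot (c *m P) u + dot (u *m P) c) +
      r ^+ 2 * dot (c *m P) c); first by ring.
    by rewrite Z1 Z2 Z3 !mulr0 !addr0.
  have [u' u'0 [E1 _]] := exists_orthogonal2 (c *m M) (c *m M) n3.
  exists u' => //; rewrite dotC E1; split=> //.
  apply: contraNneq Py => -[_ _ Z].
  by rewrite y0E uE add0r -scalemxAl !dotL Z !mulr0.
apply: (@sweep_eq0 R k _ _ _ N (dot (u *m M) u) N0 (quad_gt0 u0) _ _ Pu s sN).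
  move=> {}s {}sN; rewrite /k; apply: cvgB; apply: cvgM.
  - exact: is_derive_continuous_real (Did _ _ _ Dphi Dphi1 _ sN).
  - exact: Ch2.
  - exact: Cphi2.
  - exact: is_derive_continuous_real (Did _ _ _ Dh Dh1 _ sN).
move=> t; rewrite -slope_plane //; set y := t *: c + u.
have y0n : y != 0 by exact: plane_neq0.
have -> : dot (u *m P) u + (dot (c *m P) u + dot (u *m P) c) * t +
    dot (c *m P) c * t ^+ 2 = dot (y *m P) y.
  by rewrite /y mulmxDl -scalemxAl !dotL; ring.
have sy : 0 < N - slope y ^+ 2.
  rewrite subr_gt0 slope_plane // expr_div_n exprMn.
  have D0 : 0 < t ^+ 2 * N + dot (u *m M) u.
    by rewrite ltr_wpDl ?quad_gt0 // mulr_ge0 ?sqr_ge0 // ltW.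
  rewrite sqr_sqrtr ?ltW // ltr_pdivrMr // -subr_gt0.
  rewrite (_ : _ - _ = N * dot (u *m M) u); last by ring.
  by rewrite mulr_gt0 ?quad_gt0.
have := congr1 (dot^~ c) (hamel_phi y0n); have := congr1 (dot^~ c) (hamel_h y0n).
rewrite !hamel_row_dot !dot0l C0 dot0l !mulr0 !addr0 dslope_dual // slope_rateE //.
set X := dot (hamel_len _ _ _) c; set Q := dot (y *m P) y.
have L0 := len_gt0 y0n.
set S := slope y; rewrite -/S in sy; rewrite -/(eta S) -/(e S) => E1 E2.
have kX : k S * X = 0.
  transitivity (h2 S * 0 - phi2 S * 0); last by rewrite !mulr0 subrr.
  by rewrite -{1}E2 -E1 /k; ring.
have kQ : k S * (Q + len y * X) = 0.
  apply: (mulIf (_ : (N - S ^+ 2) / len y != 0)).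
    by rewrite mulf_neq0 ?invr_eq0 // gt_eqF.
  transitivity (e S * 0 - eta S * 0); last by rewrite !mulr0 subrr mul0r.
  by rewrite -{1}E1 -E2 /k; ring.
rewrite mulrC; move: kQ; rewrite mulrDr mulrCA kX mulr0 addr0; exact.
Qed.

End Linear.
End Pointwise.

(** * Hamel's operator on an (alpha, beta)-metric *)

Section HamelFormula.
Context {R : realType} {n : nat}.
Implicit Types (x y v w z : 'rV[R]_n).

Definition dmetric (a : 'rV[R]_n -> 'M[R]_n) x (k : 'I_n) : 'M[R]_n :=
  \matrix_(i, j) 'D_(evec k) (fun z => a z i j : R^o) x.

Definition dcovec (b : 'rV[R]_n -> 'rV[R]_n) x (k : 'I_n) : 'rV[R]_n :=
  \row_i 'D_(evec k) (fun z => b z 0 i : R^o) x.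

Lemma smooth_on_diff (V W : normedModType R) (A : set V) (f : V -> W) (x : V) :
  smooth_on A f -> A x -> differentiable f x.
Proof. by move=> /(_ 1%N)[df _]; exact: df. Qed.

Lemma derivable_entry m p (A : set 'rV[R]_n) (f : 'rV[R]_n -> 'M[R]_(m, p))
    x v i j : smooth_on A f -> A x -> derivable (fun z => f z i j : R^o) x v.
Proof.
move=> sf Ax; apply: ((derivable_mxP f x v).1 _ i j).
exact: diff_derivable (smooth_on_diff sf Ax).
Qed.

Lemma is_derive_dot (p : 'rV[R]_n) y w :
  is_derive y w (fun v => dot p v : R^o) (dot p w).
Proof.
apply/is_derive_line.
rewrite (_ : (fun h : R^o => _) = fun h : R^o => h * dot p w + dot p y : R^o).
  refine (is_derive_eq (is_derive_addf (is_derive_mulf (is_derive_id _ _)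
    (is_derive_cstf _ _ _)) (is_derive_cstf _ _ _)) _).
  by ring.
by apply/funext => h; rewrite !dotL.
Qed.

Lemma is_derive_quad (M : 'M[R]_n) y w :
  is_derive y w (fun v => dot (v *m M) v : R^o)
    (dot (w *m M) y + dot (y *m M) w).
Proof.
apply/is_derive_line.
rewrite (_ : (fun h : R^o => _) = fun h : R^o =>
  h * (h * dot (w *m M) w) + h * (dot (w *m M) y + dot (y *m M) w) +
  dot (y *m M) y : R^o).
  have Dm (f : R^o -> R^o) (k : R) : is_derive (0 : R^o) (1 : R^o) f k ->
      is_derive (0 : R^o) (1 : R^o) (fun h : R^o => h * f h : R^o) (f 0).
    move=> Df; refine (is_derive_eq (is_derive_mulf (is_derive_id _ _) Df) _).
    by rewrite mul1r mul0r addr0.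
  have D1 := Dm _ _ (is_derive_cstf (dot (w *m M) w) (0 : R^o) (1 : R^o)).
  have D0 := Dm _ _ (is_derive_cstf (dot (w *m M) y + dot (y *m M) w)
    (0 : R^o) (1 : R^o)).
  refine (is_derive_eq (is_derive_addf (is_derive_addf (Dm _ _ D1) D0)
    (is_derive_cstf _ _ _)) _).
  by rewrite /=; ring.
by apply/funext => h; rewrite mulmxDl -scalemxAl !dotL; ring.
Qed.

Section Formula.
Variables (U : set 'rV[R]_n) (a : 'rV[R]_n -> 'M[R]_n)
  (b : 'rV[R]_n -> 'rV[R]_n).
Hypotheses (openU : open U) (riem : riemannian_metric U a)
  (sb : smooth_on U b).

Let sa : smooth_on U a. Proof. by case: riem. Qed.

Lemma riem_sym x : U x -> (a x)^T = a x.
Proof. by case: riem => _ + _; apply. Qed.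

Lemma riem_pos x : U x -> posdef (a x).
Proof. by case: riem => _ _; apply. Qed.

Lemma alphaE x y : alpha a x y = len (a x) y.
Proof. by rewrite /alpha dot_quad. Qed.

Lemma norm_formE x : norm_form a b x = Num.sqrt (sqnorm (a x) (b x)).
Proof. by rewrite /norm_form dot_quad. Qed.

Lemma is_derive_quad_base x v k : U x ->
  is_derive x (evec k) (fun z => dot (v *m a z) v : R^o)
    (dot (v *m dmetric a x k) v).
Proof.
move=> Ux; rewrite -dot_quad.
rewrite (_ : (fun z => _) =
  fun z => \sum_i \sum_j a z i j * (v 0 i * v 0 j) : R^o); last first.
  apply/funext => z; rewrite -dot_quad; apply: eq_bigr => i _.
  by apply: eq_bigr => j _; rewrite mulrA.
apply: is_derive_sumf => i; apply: is_derive_sumf => j.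
refine (is_derive_eq (is_derive_mulf (derivableP
  (derivable_entry (v := evec k) (i := i) (j := j) sa Ux))
  (is_derive_cstf _ _ _)) _).
by rewrite mulr0 addr0 mxE mulrA.
Qed.

Lemma is_derive_form_base x v k : U x ->
  is_derive x (evec k) (fun z => dot (b z) v : R^o) (dot (dcovec b x k) v).
Proof.
move=> Ux; apply: is_derive_sumf => i.
refine (is_derive_eq (is_derive_mulf (derivableP
  (derivable_entry (v := evec k) (i := 0) (j := i) sb Ux))
  (is_derive_cstf _ _ _)) _).
by rewrite mulr0 addr0 mxE.
Qed.

Lemma dmetric_sym x k : U x -> (dmetric a x k)^T = dmetric a x k.
Proof.
move=> Ux; apply/matrixP => i j; rewrite !mxE; apply: near_eq_derive.
apply: near_open openU Ux _ => z Uz.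
by rewrite -{1}(riem_sym Uz) mxE.
Qed.

Variables (psi psi1 psi2 : R -> R) (D : set R) (G : 'rV[R]_n -> 'rV[R]_n -> R).
Hypothesis Dpsi : forall s, D s ->
  is_derive (s : R^o) (1 : R^o) (psi : R^o -> R^o) (psi1 s).
Hypothesis Dpsi1 : forall s, D s ->
  is_derive (s : R^o) (1 : R^o) (psi1 : R^o -> R^o) (psi2 s).
Hypothesis slopeD : forall x v, U x -> v != 0 -> D (slope (a x) (b x) v).
Hypothesis GE : forall x v, U x ->
  G x v = len (a x) v * psi (slope (a x) (b x) v).

Lemma Dx_formula x v k : U x -> v != 0 ->
  Dx G k x v =
  (psi (slope (a x) (b x) v) -
   slope (a x) (b x) v * psi1 (slope (a x) (b x) v)) *
  (dot (v *m dmetric a x k) v / (2 * len (a x) v)) +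
  psi1 (slope (a x) (b x) v) * dot (dcovec b x k) v.
Proof.
move=> Ux v0; have L0 := len_gt0 (riem_pos Ux) v0.
have Dl := is_derive_sqrtf (is_derive_quad_base v k Ux)
  (quad_gt0 (riem_pos Ux) v0).
have Ds := is_derive_divf (is_derive_form_base v k Ux) Dl (lt0r_neq0 L0).
have DG := is_derive_mulf Dl (is_derive_comp_real Ds (Dpsi (slopeD Ux v0))).
rewrite /Dx (_ : 'D_ _ _ _ = 'D_(evec k)
    (fun z => len (a z) v * psi (slope (a z) (b z) v) : R^o) x); last first.
  by apply: near_eq_derive; apply: near_open openU Ux _ => z Uz; exact: GE.
rewrite (@derive_val _ _ _ _ _ _ _ DG) -/(len (a x) v) -/(slope (a x) (b x) v).
rewrite -/(len (a x) v) in L0.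
have -> : dot (b x) v = slope (a x) (b x) v * len (a x) v.
  by rewrite /slope divfK // gt_eqF.
by field; rewrite gt_eqF.
Qed.

(** Since [alpha psi (s)] is homogeneous of degree one in [alpha] and [beta], its
    partial derivatives in these are [psi - s psi'] and [psi'], which depend on
    the slope only.  Differentiating them along the fibre produces the term in
    [psi'']. *)
Lemma hamel_formula x y l : U x -> y != 0 ->
  \sum_k Dy (Dx G k) l x y * y 0 k - Dx G l x y =
  hamel_row (a x) (b x) (dmetric a x) (dcovec b x) psi psi1 psi2 y 0 l.
Proof.
move=> Ux y0; have L0 := len_gt0 (riem_pos Ux) y0.
set M := a x; set bx := b x; set dA := dmetric a x; set dB := dcovec b x.
pose e : 'rV[R]_n := evec l.
have Dl : is_derive y e (fun v => len M v : R^o) (dot (y *m M) e / len M y).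
  refine (is_derive_eq (is_derive_sqrtf (is_derive_quad M y e)
    (quad_gt0 (riem_pos Ux) y0)) _).
  rewrite (dot_symM (riem_sym Ux)) -/(len M y); field.
  by rewrite gt_eqF.
have Ds : is_derive y e (fun v => slope M bx v : R^o) (dslope M bx y 0 l).
  refine (is_derive_eq (is_derive_divf (is_derive_dot bx y e) Dl
    (lt0r_neq0 L0)) _).
  rewrite -[RHS]dot_evec dslope_dot /slope -/e.
  by field; rewrite gt_eqF.
have DDG k : Dy (Dx G k) l x y =
  - (slope M bx y * psi2 (slope M bx y) * dslope M bx y 0 l) *
    (dot (y *m dA k) y / (2 * len M y)) +
  (psi (slope M bx y) - slope M bx y * psi1 (slope M bx y)) *
    (dot (y *m dA k) e / len M y -
     dot (y *m dA k) y * dot (y *m M) e / (2 * len M y ^+ 3)) +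
  psi2 (slope M bx y) * dslope M bx y 0 l * dot (dB k) y +
  psi1 (slope M bx y) * dB k 0 l.
  rewrite /Dy (_ : 'D_ _ _ _ = 'D_e (fun v =>
    (psi (slope M bx v) - slope M bx v * psi1 (slope M bx v)) *
    (dot (v *m dA k) v / (2 * len M v)) +
    psi1 (slope M bx v) * dot (dB k) v : R^o) y); last first.
    apply: near_eq_derive.
    apply: near_open (@open_nonzero _ _) y0 _ => v v0.
    exact: Dx_formula.
  have sD := slopeD Ux y0.
  have Dp := is_derive_comp_real Ds (Dpsi sD).
  have Dp1 := is_derive_comp_real Ds (Dpsi1 sD).
  have D1 := is_derive_subf Dp (is_derive_mulf Ds Dp1).
  have L2 : 2 * len M y != 0 by rewrite mulf_neq0 ?pnatr_eq0 // gt_eqF.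
  have D2 := is_derive_divf (is_derive_quad (dA k) y e)
    (is_derive_mulf (is_derive_cstf 2 y e) Dl) L2.
  have DG := is_derive_addf (is_derive_mulf D1 D2)
    (is_derive_mulf Dp1 (is_derive_dot (dB k) y e)).
  rewrite (@derive_val _ _ _ _ _ _ _ DG).
  have -> : dot (e *m dA k) y = dot (y *m dA k) e.
    by rewrite dot_trmx dmetric_sym.
  rewrite -/M -/bx !dot_evec.
  by field; rewrite gt_eqF.
rewrite Dx_formula // -/M -/bx -/dA -/dB.
have key (c1 c2 c3 c4 : R) : \sum_k (c1 * (y 0 k * dot (y *m dA k) y) +
    c2 * ((y *m dA k) 0 l * y 0 k) + c3 * (y 0 k * dot (dB k) y) +
    c4 * (dB k 0 l * y 0 k)) =
    c1 * dquad dA y + c2 * (\sum_k (y *m dA k) 0 l * y 0 k) +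
    c3 * dform dB y + c4 * (\sum_k dB k 0 l * y 0 k).
  by rewrite !big_split /= /dquad /dform !mulr_sumr.
transitivity (\sum_k (
  (- (slope M bx y * psi2 (slope M bx y) * dslope M bx y 0 l) / (2 * len M y) -
   (psi (slope M bx y) - slope M bx y * psi1 (slope M bx y)) *
   (y *m M) 0 l / (2 * len M y ^+ 3)) * (y 0 k * dot (y *m dA k) y) +
  ((psi (slope M bx y) - slope M bx y * psi1 (slope M bx y)) / len M y) *
    ((y *m dA k) 0 l * y 0 k) +
  (psi2 (slope M bx y) * dslope M bx y 0 l) * (y 0 k * dot (dB k) y) +
  psi1 (slope M bx y) * (dB k 0 l * y 0 k)) -
  ((psi (slope M bx y) - slope M bx y * psi1 (slope M bx y)) *
   (dot (y *m dA l) y / (2 * len M y)) +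
   psi1 (slope M bx y) * dot (dB l) y)).
  congr (_ - _); apply: eq_bigr => k _; rewrite DDG !dot_evec.
  by field; rewrite gt_eqF.
rewrite key -[RHS]dot_evec /hamel_row /hamel_len /slope_rate !dotL !dot_evec.
have -> : spray dA y 0 l = \sum_k (y *m dA k) 0 l * y 0 k -
    2^-1 * dot (y *m dA l) y by rewrite mxE.
have -> : curl dB y 0 l = \sum_k dB k 0 l * y 0 k - dot (dB l) y.
  by rewrite mxE.
have -> : dslope M bx y 0 l =
    (len M y)^-1 * (bx 0 l - slope M bx y / len M y * (y *m M) 0 l).
  by rewrite -dot_evec /dslope !dotL !dot_evec.
by field; rewrite gt_eqF.
Qed.

End Formula.
End HamelFormula.

(** * Parallel forms *)

Section Covariant.
Context {R : realType} {n : nat}.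
Variables (U : set 'rV[R]_n) (a : 'rV[R]_n -> 'M[R]_n)
  (b : 'rV[R]_n -> 'rV[R]_n).
Hypotheses (openU : open U) (riem : riemannian_metric U a)
  (sb : smooth_on U b).
Implicit Types (x y v z : 'rV[R]_n).

Local Notation c x := (dual_vec (a x) (b x)).

Definition nabla x : 'M[R]_n :=
  \matrix_(i, j) ('D_(evec j) (fun z => b z 0 i : R^o) x -
                  \sum_k christoffel a x k i j * b x 0 k).

Lemma christoffel_dual x i j : \sum_k christoffel a x k i j * b x 0 k =
  2^-1 * \sum_l c x 0 l *
    (dmetric a x i j l + dmetric a x j i l - dmetric a x l i j).
Proof.
rewrite /christoffel; under eq_bigr => k _ do rewrite -mulrA mulr_suml.
rewrite -mulr_sumr exchange_big /=; congr (_ * _); apply: eq_bigr => l _.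
rewrite /dual_vec mxE mulr_suml; apply: eq_bigr => k _; rewrite !mxE.
by rewrite mulrAC (mulrC (b x 0 k)).
Qed.

Lemma nabla_quad x y :
  dot (y *m nabla x) y = dform (dcovec b x) y - dot (spray (dmetric a x) y) (c x).
Proof.
set dA := dmetric a x; set dB := dcovec b x.
have qE (T : 'I_n -> 'I_n -> R) : \sum_i \sum_j T i j * y 0 i * y 0 j =
    \sum_i \sum_j T j i * y 0 i * y 0 j.
  rewrite exchange_big /=; apply: eq_bigr => j _; apply: eq_bigr => i _.
  by rewrite mulrAC.
rewrite -dot_quad.
transitivity (\sum_i \sum_j (dB j 0 i * y 0 i * y 0 j -
  \sum_l c x 0 l * (2^-1 * (dA i j l * y 0 i * y 0 j + dA j i l * y 0 i * y 0 j
    - dA l i j * y 0 i * y 0 j)))).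
  apply: eq_bigr => i _; apply: eq_bigr => j _.
  rewrite mxE christoffel_dual !mulrBl [dB j 0 i]mxE; congr (_ - _).
  rewrite mulr_sumr !mulr_suml; apply: eq_bigr => l _; rewrite -/dA.
  by ring.
under eq_bigr => i _ do rewrite sumrB.
rewrite sumrB; congr (_ - _).
  rewrite exchange_big /dform; apply: eq_bigr => j _; rewrite /dot mulr_sumr.
  by apply: eq_bigr => i _; rewrite mulrC.
rewrite (dotC _ (c x)) /dot.
under eq_bigr => i _ do rewrite exchange_big /=.
rewrite exchange_big /=; apply: eq_bigr => l _.
under eq_bigr => i _ do rewrite -mulr_sumr -mulr_sumr.
rewrite -!mulr_sumr; congr (_ * _).
under eq_bigr => i _ do rewrite sumrB big_split.
rewrite sumrB big_split /= (qE (fun i j => dA i j l)) dot_quad mxE -/dA.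
have -> : \sum_k (y *m dA k) 0 l * y 0 k =
    \sum_i \sum_j dA j i l * y 0 i * y 0 j.
  rewrite exchange_big /=; apply: eq_bigr => j _; rewrite mxE mulr_suml.
  by apply: eq_bigr => i _; rewrite (mulrC (y 0 i)).
by field.
Qed.

Lemma nabla_curl x i j : U x ->
  nabla x i j - nabla x j i = dcovec b x j 0 i - dcovec b x i 0 j.
Proof.
move=> Ux; rewrite !mxE !christoffel_dual.
have -> : \sum_l c x 0 l * (dmetric a x j i l + dmetric a x i j l -
    dmetric a x l j i) = \sum_l c x 0 l * (dmetric a x i j l +
    dmetric a x j i l - dmetric a x l i j).
  apply: eq_bigr => l _; congr (_ * _); rewrite (addrC (dmetric a x j i l)).
  by congr (_ - _); rewrite -{1}(dmetric_sym openU riem l Ux) mxE.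
by ring.
Qed.

Lemma curl_eq0P x : (forall y, curl (dcovec b x) y = 0) <->
  (forall i j, dcovec b x j 0 i = dcovec b x i 0 j).
Proof.
split=> [C0 i j|S y].
  have /rowP/(_ i) := C0 (evec j); rewrite [LHS]mxE [RHS]mxE dot_evec => /eqP.
  rewrite subr_eq0 (bigD1 j) //= big1 => [|k kj]; rewrite !mxE ?eqxx.
    by rewrite mulr1 addr0 => /eqP.
  by rewrite (negbTE kj) andbF mulr0.
apply/rowP => l; rewrite [LHS]mxE [RHS]mxE; apply/eqP; rewrite subr_eq0; apply/eqP.
by apply: eq_bigr => k _; rewrite S.
Qed.

(** The Christoffel symbols are symmetric, so the antisymmetric part of the
    covariant derivative is the exterior derivative. *)
Lemma nabla_eq0P x : U x -> nabla x = 0 <->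
  (forall y, curl (dcovec b x) y = 0) /\
  (forall y, dot (y *m nabla x) y = 0).
Proof.
move=> Ux; split=> [n0|[/curl_eq0P C0 Q0]].
  split=> [|y]; last by rewrite n0 mulmx0 dot0l.
  apply/curl_eq0P => i j; apply/eqP.
  by rewrite -subr_eq0 -nabla_curl // n0 !mxE subrr.
have S i j : nabla x i j = nabla x j i.
  by apply/eqP; rewrite -subr_eq0 nabla_curl // C0 subrr.
apply/matrixP => i j.
have E k l : dot (evec k *m nabla x) (evec l) = nabla x k l.
  by rewrite dot_evec -rowE mxE.
have := Q0 (evec i + evec j); rewrite mulmxDl !dotL !Q0 !E (S j i) add0r addr0.
by move=> H; rewrite [RHS]mxE; lra.
Qed.

Lemma parallelP (K : set 'rV[R]_n) :
  parallel_form K a b <-> forall x, K x -> nabla x = 0.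
Proof.
split=> H x Kx; first by apply/matrixP => i j; rewrite !mxE H.
by move=> i j; have /matrixP/(_ i j) := H x Kx; rewrite !mxE.
Qed.

Lemma differentiable_entry m p (f : 'rV[R]_n -> 'M[R]_(m, p)) x i j :
  differentiable f x -> differentiable (fun z => f z i j : R^o) x.
Proof.
move=> df; apply: (@differentiable_comp _ _ _ _ f (fun M => M i j : R^o)) => //.
exact: differentiable_coord.
Qed.

Lemma differentiable_det m (f : 'rV[R]_n -> 'M[R]_m) x :
  (forall i j, differentiable (fun z => f z i j : R^o) x) ->
  differentiable (fun z => \det (f z) : R^o) x.
Proof.
move=> df.
have dprod (I : Type) (r : seq I) (h : I -> 'rV[R]_n -> R^o) :
    (forall i, differentiable (h i) x) ->
    differentiable (fun z => \prod_(i <- r) h i z : R^o) x.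
  move=> dh; elim: r => [|i r IH].
    rewrite (_ : (fun z => _) = cst 1); first exact: differentiable_cst.
    by apply/funext => z; rewrite big_nil.
  rewrite (_ : (fun z => _) = h i * (fun z => \prod_(i <- r) h i z)).
    exact: differentiableM.
  by apply/funext => z; rewrite big_cons.
have dsum (I : Type) (r : seq I) (h : I -> 'rV[R]_n -> R^o) :
    (forall i, differentiable (h i) x) ->
    differentiable (fun z => \sum_(i <- r) h i z : R^o) x.
  move=> dh; elim: r => [|i r IH].
    rewrite (_ : (fun z => _) = cst 0); first exact: differentiable_cst.
    by apply/funext => z; rewrite big_nil.
  rewrite (_ : (fun z => _) = h i + (fun z => \sum_(i <- r) h i z)).
    exact: differentiableD.
  by apply/funext => z; rewrite big_cons.
apply: dsum => s.
rewrite (_ : (fun z => _) = ((-1) ^+ s : R) *: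
  (fun z => \prod_i f z i (s i) : R^o)); last by [].
by apply: differentiableZ; apply: dprod => i; exact: df.
Qed.

Lemma differentiable_dual x i : U x -> differentiable (fun z => c z 0 i : R^o) x.
Proof.
move=> Ux; case: (riem) => sa _ pa.
have da j k : differentiable (fun z => a z j k : R^o) x.
  by apply: differentiable_entry; exact: smooth_on_diff sa Ux.
have db k : differentiable (fun z => b z 0 k : R^o) x.
  by apply: differentiable_entry; exact: smooth_on_diff sb Ux.
have dinv j k : differentiable (fun z => invmx (a z) j k : R^o) x.
  apply: (@near_eq_differentiable _ _ _
    (fun z => (\det (a z))^-1 * \adj (a z) j k : R^o)).
    apply: near_open openU Ux _ => z Uz.
    by rewrite /invmx posdef_unitmx ?mxE //; exact: pa.
  apply: differentiableM.
    apply: differentiableV; first exact: differentiable_det.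
    by rewrite -unitfE -unitmxE posdef_unitmx //; exact: pa.
  rewrite (_ : (fun z => _) = ((-1) ^+ (k + j) : R) *:
    (fun z => \det (row' k (col' j (a z))) : R^o)); last first.
    by apply/funext => z; rewrite mxE.
  apply: differentiableZ; apply: differentiable_det => r s.
  rewrite (_ : (fun z => _) = fun z => a z (lift k r) (lift j s) : R^o) //.
  by apply/funext => z; rewrite !mxE.
rewrite (_ : (fun z => _) = \sum_k (fun z => b z 0 k * invmx (a z) k i : R^o)).
  by apply: differentiable_sum => k; exact: differentiableM.
by apply/funext => z; rewrite mxE fct_sumE.
Qed.

Lemma differentiable_sqnorm x : U x ->
  differentiable (fun z => sqnorm (a z) (b z) : R^o) x.
Proof.
move=> Ux.
rewrite (_ : (fun z => _) = \sum_k (fun z => c z 0 k * b z 0 k : R^o)).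
  apply: differentiable_sum => k; apply: differentiableM.
    exact: differentiable_dual.
  by apply: differentiable_entry; exact: smooth_on_diff sb Ux.
by apply/funext => z; rewrite fct_sumE.
Qed.

(** With [c = b a^-1], so that [c a = b], the derivative of [c b] is
    [2 c b' - c a' c]; the derivative of the inverse matrix is never computed, only
    its existence is used.  For a parallel form [c b'] is half of [c a' c], because
    two of the three terms of the Christoffel symbols cancel. *)
Lemma parallel_sqnorm x v : U x -> nabla x = 0 ->
  is_derive x v (fun z => sqnorm (a z) (b z) : R^o) (0 : R).
Proof.
move=> Ux n0; have dN := differentiable_sqnorm Ux.
apply: DeriveDef; first exact: diff_derivable.
suff De k : 'D_(evec k) (fun z => sqnorm (a z) (b z) : R^o) x = 0.
  rewrite deriveE // (row_evec v) linear_sum big1 // => k _.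
  by rewrite linearZ /= -deriveE // De scaler0.
set dA := dmetric a x k; set dB := dcovec b x k.
pose dc : 'rV[R]_n := \row_i 'D_(evec k) (fun z => c z 0 i : R^o) x.
have Dc i : is_derive x (evec k) (fun z => c z 0 i : R^o) (dc 0 i).
  by rewrite mxE; apply/derivableP/diff_derivable/differentiable_dual.
case: (riem) => sa _ pa.
have Da i j : is_derive x (evec k) (fun z => a z i j : R^o) (dA i j).
  by rewrite mxE; apply/derivableP; exact: derivable_entry sa Ux.
have Db i : is_derive x (evec k) (fun z => b z 0 i : R^o) (dB 0 i).
  by rewrite mxE; apply/derivableP; exact: derivable_entry sb Ux.
have cE : dB = dc *m a x + c x *m dA.
  apply/rowP => j; rewrite -[LHS](@derive_val _ _ _ _ _ _ _ (Db j)).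
  rewrite (_ : 'D_ _ _ _ =
    'D_(evec k) (fun z => \sum_i c z 0 i * a z i j : R^o) x).
    rewrite (@derive_val _ _ _ _ _ _ _
      (is_derive_sumf (fun i => is_derive_mulf (Dc i) (Da i j)))).
    by rewrite big_split !mxE.
  apply: near_eq_derive; apply: near_open openU Ux _ => z Uz.
  by rewrite -{1}(dual_vecK (b z) (pa z Uz)) mxE.
have -> : 'D_(evec k) (fun z => sqnorm (a z) (b z) : R^o) x =
    dot dc (b x) + dot (c x) dB.
  rewrite (@derive_val _ _ _ _ _ _ _
    (is_derive_sumf (fun i => is_derive_mulf (Dc i) (Db i)))).
  by rewrite big_split.
have bE : dot (c x) dB = 2^-1 * dot (c x *m dA) (c x).
  transitivity (\sum_i c x 0 i * (2^-1 * \sum_l c x 0 l *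
    (dmetric a x i k l + dmetric a x k i l - dmetric a x l i k))).
    apply: eq_bigr => i _; rewrite -christoffel_dual; congr (_ * _).
    have /matrixP/(_ i k) := n0; rewrite !mxE => /eqP.
    by rewrite subr_eq0 => /eqP.
  under eq_bigr => i _ do rewrite mulrCA mulr_sumr.
  rewrite -mulr_sumr; congr (_ * _); rewrite -dot_quad.
  have swap : \sum_i \sum_l c x 0 i * (c x 0 l * dmetric a x i k l) =
      \sum_i \sum_l c x 0 i * (c x 0 l * dmetric a x l i k).
    rewrite exchange_big /=; apply: eq_bigr => l _; apply: eq_bigr => i _.
    rewrite mulrCA; congr (_ * (_ * _)).
    by rewrite -{1}(dmetric_sym openU riem i Ux) mxE.
  transitivity (\sum_i \sum_l c x 0 i * (c x 0 l * dmetric a x i k l) +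
    \sum_i \sum_l dA i l * c x 0 i * c x 0 l -
    \sum_i \sum_l c x 0 i * (c x 0 l * dmetric a x l i k)).
    rewrite -big_split -sumrB; apply: eq_bigr => i _ /=.
    rewrite -big_split -sumrB; apply: eq_bigr => l _ /=.
    by rewrite -/dA; ring.
  by rewrite swap; ring.
have dcE : dot dc (b x) = dot dB (c x) - dot (c x *m dA) (c x).
  rewrite cE dotDl addrK (dot_symM (riem_sym riem Ux)).
  by rewrite (dual_vecK (b x) (pa x Ux)); exact: dotC.
by rewrite dcE (dotC dB) bE; field.
Qed.

End Covariant.

(** * Local constancy on components *)

Section LocalConstancy.
Context {R : realType} {V : normedModType R}.
Implicit Types (U : set V) (x z w : V).

Lemma ball_segment z w (e t : R) : 0 <= t -> t <= 1 -> ball z e w ->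
  ball z e (t *: (w - z) + z).
Proof.
rewrite -!ball_normE /ball_ /= => t0 t1 zw.
rewrite opprD addrCA subrr addr0 normrN normrZ ger0_norm // -normrN opprB.
by apply: le_lt_trans zw; rewrite ler_piMl.
Qed.

Lemma ball_connected z (e : R) : 0 < e -> connected (ball z e).
Proof.
move=> e0; pose S w := [set t *: (w - z) + z | t in `[0 : R^o, 1]].
have -> : ball z e = \bigcup_(w in ball z e) S w.
  apply/seteqP; split=> [w zw|w [u zu [t]]].
    exists w => //; exists 1; first by rewrite /= in_itv /= ler01 lexx.
    by rewrite scale1r subrK.
  by rewrite /= in_itv /= => /andP[t0 t1] <-; exact: ball_segment.
apply: bigcup_connected.
  exists z => w _; exists 0; first by rewrite /= in_itv /= ler01 lexx.
  by rewrite scale0r add0r.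
move=> w zw; apply: connected_continuous_connected.
  exact: segment_connected.
apply: continuous_subspaceT => t.
apply: cvgD; last exact: cvg_cst.
by apply: cvgZl; exact: cvg_id.
Qed.

Lemma open_connected_component U x : open U -> open (connected_component U x).
Proof.
move=> oU; rewrite openE => z Kz; have Uz := connected_component_sub Kz.
have /nbhs_ballP[e /= e0 zeU] : nbhs z U by exact: open_nbhs_nbhs.
apply/nbhs_ballP; exists e => //=; rewrite (same_connected_component Kz).
by apply: connected_component_max => //; [exact: ballxx | exact: ball_connected].
Qed.


Lemma locally_constant_component U (f : V -> R) x z : open U ->
  (forall z, U z -> nbhs z [set w | f w = f z]) ->
  connected_component U x z -> f z = f x.
Proof.
move=> oU lf Kz; set K := connected_component U x.
have KU : K `<=` U := @connected_component_sub _ _ _.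
have Ux : U x.
  by apply: contrapT => nUx; move: Kz; rewrite connected_component_out.
have op (Q : R -> Prop) : open [set w | U w /\ Q (f w)].
  rewrite openE => w [Uw Qw].
  have nU : nbhs w U by exact: open_nbhs_nbhs.
  by apply: filterS2 (lf w Uw) nU => u /= -> Uu; split.
suff KE : K `&` [set w | f w = f x] = K by move: Kz; rewrite -/K -KE => -[].
apply: component_connected.
- by exists x; split => //; exact: connected_component_refl.
- exists [set w | U w /\ f w = f x]; first exact: (op (fun r => r = f x)).
  by apply/seteqP; split=> w /= [Kw]; [split=> //; split=> //; exact: KU | case].
- exists (~` [set w | U w /\ f w <> f x]).
    exact: open_closedC (op (fun r => r <> f x)).
  apply/seteqP; split=> w /= [Kw fw]; split=> //; first by move=> [].
  by apply: contrapT => nfw; apply: fw; split=> //; exact: KU.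
Qed.

Lemma derive0_locally_constant U (f : V -> R^o) z : open U ->
  (forall w v, U w -> is_derive w v f (0 : R)) -> U z ->
  nbhs z [set w | f w = f z].
Proof.
move=> oU Df Uz.
have /nbhs_ballP[e /= e0 zeU] : nbhs z U by exact: open_nbhs_nbhs.
apply/nbhs_ballP; exists e => //= w zw.
pose g (t : R^o) : R^o := f (t *: (w - z) + z).
have Dg t : 0 <= t -> t <= 1 -> is_derive (t : R^o) (1 : R^o) g (0 : R).
  move=> t0 t1; have /is_derive_line D0 :=
    Df _ (w - z) (zeU _ (ball_segment t0 t1 zw)).
  pose k (h : R^o) : R^o := f (h *: (w - z) + (t *: (w - z) + z)).
  have -> : g = k \o (fun h => h - t).
    by apply/funext => h; rewrite /g /k /= addrA -scalerDl subrK.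
  refine (is_derive_eq (@is_derive1_comp R k (fun h => h - t) t 0 1 _ _) _).
  - by rewrite subrr.
  - refine (is_derive_eq (is_derive_subf (is_derive_id _ _)
      (is_derive_cstf t _ _)) _).
    by rewrite subr0.
  by rewrite mul0r.
have [t /subset_itv_oo_cc||t _] := @MVT_segment R g (fun=> 0) 0 1 ler01.
- by rewrite in_itv /= => /andP[t0 t1]; exact: Dg.
- apply: continuous_in_subspaceT => t; rewrite inE /= in_itv /= => /andP[t0 t1].
  exact: is_derive_continuous_real (Dg t t0 t1).
by rewrite mul0r /g scale1r subrK scale0r add0r => /eqP; rewrite subr_eq0 => /eqP.
Qed.

(** Squaring makes the truncation [max u 0] differentiable at [0] too. *)
Lemma is_derive_sqr_pos (u : R) : is_derive (u : R^o) (1 : R^o)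
  (fun u : R^o => Num.max u 0 ^+ 2 : R^o) (2 * Num.max u 0).
Proof.
have [u0|u0|u0] := ltrgt0P u.
- apply: (@near_eq_is_derive _ _ _ (fun t : R^o => t ^+ 2 : R^o)).
    have : nbhs (u : R^o) [set t | 0 < t] by exact: lt_nbhsr.
    by apply: filterS => t /= t0; rewrite /= max_l // ltW.
  refine (is_derive_eq (is_deriveX 2 (is_derive_id (u : R^o) (1 : R^o))) _).
  by rewrite /GRing.scale /= mulr1 expr1.
- apply: (@near_eq_is_derive _ _ _ (fun t : R^o => 0 : R^o)).
    have : nbhs (u : R^o) [set t | t < 0] by exact: lt_nbhsl.
    by apply: filterS => t /= t0; rewrite /= max_r ?expr0n // ltW.
  by rewrite mulr0; exact: is_derive_cstf.
rewrite u0.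
have C : (fun h : R^o => h^-1 *: (Num.max (h *: (1 : R^o) + 0) 0 ^+ 2 -
    Num.max 0 0 ^+ 2) : R^o) @ 0^' --> (0 : R^o).
  apply/cvgrPdist_lt => e e0; near=> h.
  have h0 : h != 0 by near: h; exact: nbhs_dnbhs_neq.
  rewrite sub0r normrN addr0 maxxx expr0n subr0 [_ *: 1]mulr1.
  have he : `|h| < e by near: h; exact: dnbhs0_lt.
  have [hp|hn] := lerP 0 h.
    by rewrite expr2 [_ *: _]mulKf.
  by rewrite expr0n scaler0 normr0.
rewrite mulr0; apply: DeriveDef; first exact: cvgP C.
exact: cvg_lim C.
Unshelve. all: by end_near. Qed.

End LocalConstancy.

(** * Strong convexity under the addition of a one-form *)

Section FundamentalTensor.
Context {R : realType} {n : nat}.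
Local Notation V := 'rV[R]_n.
Implicit Types (x y v w : V).

(** If [f = p . y] and [q . y] are positive and [y] is in the kernel of [H],
    then [p p^T + f H] and [q q^T + g H], with [g = q . y], are positive
    definite together: both conditions say that [H] is positive definite modulo
    [y]. *)
Lemma posdef_shift (H : 'M[R]_n) (p q y : V) : y *m H = 0 ->
  H *m y^T = 0 -> 0 < dot p y -> 0 < dot q y ->
  (forall v, v != 0 -> 0 < dot p v ^+ 2 + dot p y * dot (v *m H) v) ->
  forall v, v != 0 -> 0 < dot q v ^+ 2 + dot q y * dot (v *m H) v.
Proof.
move=> yH Hy f0 g0 Hp v v0.
set t := dot p v / dot p y; pose w := v - t *: y.
have vE : v = w + t *: y by rewrite subrK.
have pw : dot p w = 0.
  by rewrite /w !dotL /t divfK ?subrr // gt_eqF.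
have Hr u : dot (u *m H) y = 0 by rewrite dotE -mulmxA Hy mulmx0 mxE.
have HE : dot (v *m H) v = dot (w *m H) w.
  by rewrite vE mulmxDl -scalemxAl yH scaler0 addr0 dotDr dotZr Hr mulr0 addr0.
have [w0|w0] := eqVneq w 0.
  have t0 : t != 0.
    by apply: contraNneq v0 => t0; rewrite vE w0 t0 scale0r addr0.
  rewrite HE w0 mul0mx dot0l mulr0 addr0 vE w0 add0r dotZr.
  by rewrite exprn_even_gt0 //= mulf_neq0 // gt_eqF.
have := Hp w w0; rewrite pw expr0n add0r pmulr_rgt0 // => Hw.
by rewrite ltr_wpDl ?sqr_ge0 // HE mulr_gt0.
Qed.

Section Homogeneous.
Variable f : V -> R^o.
Hypothesis homf : forall y (c : R), 0 < c -> f (c *: y) = c * f y.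
Hypothesis df : forall y, y != 0 -> differentiable f y.

Lemma derive_homogeneous y w (c : R) : y != 0 -> 0 < c ->
  'D_w f (c *: y) = 'D_w f y.
Proof.
move=> y0 c0.
have fE : f = (fun v => c * f (c^-1 *: v) : R^o).
  by apply/funext => v; rewrite homf ?invr_gt0 // mulrA divff ?mul1r // gt_eqF.
have cy : c^-1 *: (c *: y) = y by rewrite scalerA mulVf ?scale1r // gt_eqF.
have D := @derive_affine R V V R^o f (fun v => c^-1 *: v) (fun v => c^-1 *: v)
  (c *: y) w _ _.
have {}D : 'D_w (fun v => f (c^-1 *: v)) (c *: y) = c^-1 * 'D_w f y.
  rewrite D; last 2 first.
  - by move=> k u; rewrite !scalerA mulrC.
  - by move=> z h; rewrite scalerDr.
  by rewrite cy !deriveE ?linearZ //; exact: df.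
rewrite {1}fE.
have dv : derivable (fun v => f (c^-1 *: v)) (c *: y) w.
  apply/diff_derivable.
  apply: (@differentiable_comp _ _ _ _ (fun v => c^-1 *: v) f).
    by apply: ex_diff.
  by rewrite cy; exact: df.
transitivity (c *: 'D_w (fun v => f (c^-1 *: v)) (c *: y)).
  exact: (@deriveZ _ _ _ (fun v => f (c^-1 *: v))).
by rewrite D /GRing.scale /= mulrA divff ?mul1r // gt_eqF.
Qed.

Lemma euler1 y : y != 0 -> 'D_y f y = f y.
Proof.
move=> y0; apply: (@derive_val _ _ _ y y f); apply/is_derive_line.
apply: (@near_eq_is_derive _ _ _ (fun h : R^o => (h + 1) * f y : R^o)).
  have : nbhs (0 : R^o) [set h | - 1 < h] by apply: lt_nbhsr; lra.
  apply: filterS => h /= h1; rewrite -homf; last lra.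
  by rewrite scalerDl scale1r.
refine (is_derive_eq (is_derive_mulf (is_derive_addf (is_derive_id _ _)
  (is_derive_cstf 1 _ _)) (is_derive_cstf (f y) _ _)) _).
by ring.
Qed.

Lemma euler2 y w : y != 0 -> 'D_y ('D_w f) y = 0.
Proof.
move=> y0; apply: (@derive_val _ _ _ y y ('D_w f)); apply/is_derive_line.
apply: (near_eq_is_derive _ (is_derive_cstf ('D_w f y) (0 : R^o) (1 : R^o))).
have : nbhs (0 : R^o) [set h | - 1 < h] by apply: lt_nbhsr; lra.
apply: filterS => h /= h1; rewrite -[X in _ + X]scale1r -scalerDl.
by rewrite derive_homogeneous //; lra.
Qed.

Hypothesis ddf : forall w y, y != 0 -> differentiable ('D_w f : V -> R^o) y.

Definition hess y : 'M[R]_n := \matrix_(i, j) 'D_(evec j) ('D_(evec i) f) y.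
Definition grad y : V := \row_i 'D_(evec i) f y.

Lemma derive_grad (g : V -> R^o) y v : differentiable g y ->
  'D_v g y = dot (\row_i 'D_(evec i) g y) v.
Proof.
move=> dg; rewrite deriveE // {1}(row_evec v) linear_sum /dot.
by apply: eq_bigr => i _; rewrite linearZ /= -deriveE // mxE mulrC.
Qed.

Lemma grad_dot y : y != 0 -> dot (grad y) y = f y.
Proof. by move=> y0; rewrite -derive_grad ?euler1 //; exact: df. Qed.

Lemma hess_mulr y : y != 0 -> hess y *m y^T = 0.
Proof.
move=> y0; apply/matrixP => i j; rewrite [RHS]mxE -(euler2 (evec i) y0).
rewrite derive_grad; last exact: ddf.
by rewrite mxE; apply: eq_bigr => k _; rewrite !mxE (ord1 j).
Qed.

(** Obtained by differentiating Euler's identity for [f], whereas hess_mulr rests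
    on the gradient being homogeneous of degree zero. *)
Lemma hess_mull y : y != 0 -> y *m hess y = 0.
Proof.
move=> y0; apply/rowP => j; rewrite [RHS]mxE.
have E : \near y, dot (grad y) y = f y.
  by apply: near_open (@open_nonzero _ _) y0 _ => v v0; exact: grad_dot.
have Dg i : is_derive y (evec j) (fun v => grad v 0 i : R^o) (hess y i j).
  rewrite (_ : (fun v => _) = ('D_(evec i) f : V -> R^o)); last first.
    by apply/funext => v; rewrite mxE.
  by rewrite mxE; apply/derivableP/diff_derivable/ddf.
have Dy i : is_derive y (evec j) (fun v : V => v 0 i : R^o) ((evec j : V) 0 i).
  rewrite -[X in is_derive _ _ _ X]dot_evec (dotC (evec j)).
  rewrite (_ : (fun v => _) = (fun v => dot (evec i) v : R^o)).
    exact: is_derive_dot.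
  by apply/funext => v; rewrite dotC dot_evec.
have := near_eq_derive (evec j) E.
rewrite (@derive_val _ _ _ _ _ _ _
  (is_derive_sumf (fun i => is_derive_mulf (Dg i) (Dy i)))).
rewrite big_split /= -/(dot (grad y) (evec j)) dot_evec mxE => /eqP.
rewrite -subr_eq0 addrK => /eqP S; rewrite mxE -[RHS]S.
by apply: eq_bigr => i _; rewrite mulrC.
Qed.

End Homogeneous.

Lemma fundamental_tensor_shift (F : V -> V -> R) (theta : V -> V) x y i j :
  (forall y, y != 0 -> differentiable (F x : V -> R^o) y) ->
  (forall w y, y != 0 -> differentiable ('D_w (F x : V -> R^o) : V -> R^o) y) ->
  y != 0 ->
  fundamental_tensor (fun z v => F z v + one_form theta z v) x y i j =
  (grad (F x) y + theta x) 0 i * (grad (F x) y + theta x) 0 j +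
  (F x y + one_form theta x y) * hess (F x) y i j.
Proof.
move=> df ddf y0; set f : V -> R^o := F x.
have Df v w : v != 0 -> is_derive v w f ('D_w f v).
  by move=> v0; apply/derivableP/diff_derivable/df.
have DG v w : v != 0 ->
    is_derive v w (fun u => f u + dot (theta x) u : R^o)
      ('D_w f v + dot (theta x) w).
  move=> v0; exact: is_derive_addf (Df v w v0) (is_derive_dot _ _ _).
have D1 v : v != 0 ->
    Dy (fun z v => 2^-1 * (F z v + one_form theta z v) ^+ 2) i x v =
    (f v + dot (theta x) v) * ('D_(evec i) f v + dot (theta x) (evec i)).
  move=> v0.
  have D := is_derive_mulf (is_derive_cstf 2^-1 v (evec i))
    (is_derive_mulf (DG v (evec i) v0) (DG v (evec i) v0)).
  rewrite /Dy; transitivity ('D_(evec i) (fun v => 2^-1 * ((f v + dot (theta x) v) *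
    (f v + dot (theta x) v)) : R^o) v); first by [].
  rewrite (@derive_val _ _ _ _ _ _ _ D) /=; by field.
rewrite [LHS]mxE; transitivity ('D_(evec j) (fun v =>
  (f v + dot (theta x) v) * ('D_(evec i) f v + dot (theta x) (evec i)) : R^o) y).
  apply: near_eq_derive; apply: near_open (@open_nonzero _ _) y0 _ => v v0.
  exact: D1.
have DD : is_derive y (evec j) ('D_(evec i) f : V -> R^o)
    ('D_(evec j) ('D_(evec i) f) y).
  exact/derivableP/diff_derivable/ddf.
rewrite (@derive_val _ _ _ _ _ _ _ (is_derive_mulf (DG y (evec j) y0)
  (is_derive_addf DD (is_derive_cstf _ _ _)))).
rewrite /= !dot_evec !mxE -/(dot (theta x) y).
by rewrite -[one_form theta x y]/(dot (theta x) y) /f; ring.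
Qed.

(** Adding a one-form changes neither the Hessian of [F] along the fibres nor,
    as long as the sum stays positive, the convexity of [F]. *)
Lemma posdef_fundamental_shift (U : set V) (F : V -> V -> R) (theta : V -> V) x y :
  finsler_metric U F -> U x -> y != 0 -> 0 < F x y ->
  0 < F x y + one_form theta x y ->
  posdef (fundamental_tensor (fun z v => F z v + one_form theta z v) x y).
Proof.
move=> finF Ux y0 F0 G0.
have Ck k : Ck_on k [set v : V | v != 0] (F x : V -> R^o).
  pose L : V -> V * V := fun v => (0, v).
  have linL : linear L.
    by move=> c u v; rewrite /L; congr pair; rewrite /= scaler0 addr0.
  have := @Ck_on_affine R (V * V)%type V R^o k
    [set p : V * V | U p.1 /\ p.2 != 0] (fun q => F q.1 q.2 : R^o)
    (fun v => (x, v)) L linL _ _ (finsler_smooth finF k).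
  rewrite (_ : [set z | _] = [set v : V | v != 0]); last first.
    by apply/seteqP; split=> v /=; [case | split].
  apply.
    move=> v; apply: (@cvg_pair _ _ _ (nbhs v) (nbhs (0 : V)) (nbhs v) _ _ _
      (fun=> 0) id); [exact: cvg_cst | exact: cvg_id].
  by move=> z h; congr pair; rewrite /= add0r.
have [df _] := Ck 1%N.
have ddf w v : v != 0 -> differentiable ('D_w (F x : V -> R^o) : V -> R^o) v.
  by have [_ /(_ w)[dd _]] := Ck 2%N; exact: dd.
have homF v (c : R) : 0 < c -> F x (c *: v) = c * F x v.
  by move=> c0; exact: (finsler_homogeneous finF).
have FT (th : V -> V) v : dot (v *m fundamental_tensor
    (fun z v => F z v + one_form th z v) x y) v =
    dot (grad (F x) y + th x) v ^+ 2 +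
    (F x y + one_form th x y) * dot (v *m hess (F x) y) v.
  rewrite (_ : fundamental_tensor _ _ _ =
    (grad (F x) y + th x)^T *m (grad (F x) y + th x) +
    (F x y + one_form th x y) *: hess (F x) y); last first.
    apply/matrixP => i j; rewrite fundamental_tensor_shift // [RHS]mxE.
    by rewrite [X in _ = _ + X]mxE [X in _ = X + _]mxE big_ord1 [_^T _ _]mxE.
  rewrite mulmxDr -scalemxAr [in LHS]dotDl dotZl; congr (_ + _).
  set g := grad _ _ + _; rewrite mulmxA.
  have -> : v *m g^T = (dot v g)%:M.
    by apply/matrixP => i j; rewrite !ord1 -dotE [RHS]mxE eqxx.
  rewrite mul_scalar_mx. by rewrite dotZl (dotC v).
have Gdot (th : V -> V) : dot (grad (F x) y + th x) y = F x y + one_form th x y.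
  by rewrite dotDl (@grad_dot (F x)).
apply/posdefE => v v0; rewrite FT -Gdot.
apply: (@posdef_shift (hess (F x) y) (grad (F x) y)) => //.
- exact: hess_mull.
- exact: hess_mulr.
- by rewrite grad_dot.
- by rewrite Gdot.
move=> u u0; rewrite grad_dot //.
have Fu := (posdefE _).1 (finsler_convex finF Ux y0) u u0.
apply: (lt_le_trans Fu); rewrite le_eqVlt; apply/orP; left; apply/eqP.
have o0 z w : one_form (fun=> 0 : V) z w = 0 by exact: dot0l.
have := FT (fun=> 0) u; rewrite o0 [grad _ _ + _]addr0 [F x y + 0]addr0.
apply: etrans; congr (dot (u *m fundamental_tensor _ x y) u).
by apply/funext => z; apply/funext => w; rewrite o0 addr0.
Qed.

End FundamentalTensor.

(** * The reversible part of F *)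

Section ReversiblePart.
Context {R : realType} {n : nat}.
Local Notation V := 'rV[R]_n.
Variables (U : set V) (a : V -> 'M[R]_n) (b : V -> V) (phi : R -> R)
  (bo : \bar R) (F : V -> V -> R).
Hypotheses (openU : open U) (abF : ab_metric U a b phi bo F).
Implicit Types (x y v z : V) (s t : R).

Local Notation dom := [set s : R | (`|s|%:E < bo)%E].
Local Notation phi1 := (derive1 phi).
Local Notation phi2 := (derive1n 2 phi).
Local Notation N x := (sqnorm (a x) (b x)).
Local Notation slope_at x := (slope (a x) (b x)).
Local Notation hamel_at x := (hamel_row (a x) (b x) (dmetric a x) (dcovec b x)).

Let riem : riemannian_metric U a. Proof. exact: ab_riemannian abF. Qed.
Let sb : smooth_on U b. Proof. exact: ab_one_form abF. Qed.

Lemma open_dom : open (dom : set R^o).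
Proof.
case: bo => [r| |].
- rewrite (_ : mkset _ = ball (0 : R^o) r); first exact: ball_open.
  by apply/seteqP; split=> s; rewrite -ball_normE /= /ball_ /= sub0r normrN lte_fin.
- rewrite (_ : mkset _ = setT); first exact: openT.
  by apply/seteqP; split=> s //= _; rewrite ltry.
rewrite (_ : mkset _ = set0); first exact: open0.
by apply/seteqP; split.
Qed.

Lemma domN s : dom s -> dom (- s).
Proof. by rewrite /= normrN. Qed.

Lemma dom_le s (c : R) : `|s| <= c -> (c%:E < bo)%E -> dom s.
Proof. by move=> sc; apply: le_lt_trans; rewrite lee_fin. Qed.

Lemma is_derive_phi s : dom s ->
  is_derive (s : R^o) (1 : R^o) (phi : R^o -> R^o) (phi1 s).
Proof.
move=> ds; rewrite derive1E; apply/derivableP/diff_derivable.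
exact: smooth_on_diff (ab_phi_smooth abF) ds.
Qed.

Lemma derive1_D (f : R^o -> R^o) : derive1 f = 'D_(1 : R^o) f.
Proof. by apply/funext => t; rewrite derive1E. Qed.

Lemma is_derive_phi1 s : dom s ->
  is_derive (s : R^o) (1 : R^o) (phi1 : R^o -> R^o) (phi2 s).
Proof.
move=> ds; have [_ /(_ (1 : R^o))[dd _]] := ab_phi_smooth abF 2%N.
rewrite derive1nS derive1n1 derive1E; apply/derivableP/diff_derivable.
by rewrite (derive1_D phi); exact: dd.
Qed.

Lemma continuous_phi2 s : dom s -> {for s, continuous (phi2 : R^o -> R^o)}.
Proof.
move=> ds; have [_ /(_ (1 : R^o))[_ /(_ (1 : R^o)) dd]] := ab_phi_smooth abF 2%N.
rewrite (_ : phi2 = 'D_(1 : R^o) ('D_(1 : R^o) (phi : R^o -> R^o))).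
  exact: dd.
by rewrite derive1nS derive1n1 (derive1_D (derive1 phi)) (derive1_D phi).
Qed.

Lemma sqr_le_norm x s : U x -> s ^+ 2 <= N x -> `|s| <= norm_form a b x.
Proof.
by move=> Ux sN; rewrite norm_formE -sqrtr_sqr ler_wsqrtr.
Qed.

Lemma sqr_le_dom x s : U x -> s ^+ 2 <= N x -> dom s.
Proof.
move=> Ux sN; apply: dom_le (ab_norm abF Ux).
exact: sqr_le_norm.
Qed.

Lemma slope_dom x v : U x -> v != 0 -> dom (slope_at x v).
Proof.
move=> Ux v0; apply: (sqr_le_dom Ux).
exact: (slope_sqr_le (b x) (riem_sym riem Ux) (riem_pos riem Ux) v0).
Qed.

Lemma ab_formE x v : U x -> F x v = len (a x) v * phi (slope_at x v).
Proof. by move=> Ux; rewrite (ab_form abF) // alphaE. Qed.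

Lemma phi_conv0 s : dom s -> 0 < phi s - s * phi1 s.
Proof.
move=> ds; have := ab_phi_convex abF (lexx `|s|) ds.
by rewrite real_normK ?num_real // subrr mul0r addr0.
Qed.

Section Flat.
Hypothesis pfF : projectively_flat U F.

Lemma hamel_row_phi x y : U x -> y != 0 -> hamel_at x phi phi1 phi2 y = 0.
Proof.
move=> Ux y0; apply/rowP => l.
rewrite -(hamel_formula openU riem sb is_derive_phi is_derive_phi1 slope_dom
  ab_formE l Ux y0).
by rewrite pfF // mxE.
Qed.

Lemma nabla_or_linear (n3 : (3 <= n)%N) x : U x -> nabla a b x = 0 \/
  forall s, s ^+ 2 < N x -> odd_part phi s = phi1 0 * s.
Proof.
move=> Ux; have Ms := riem_sym riem Ux; have Mp := riem_pos riem Ux.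
have sd s : s ^+ 2 < N x -> dom s by move=> /ltW; exact: sqr_le_dom.
have Dp s : s ^+ 2 < N x -> is_derive (s : R^o) (1 : R^o) (phi : R^o -> R^o) (phi1 s).
  by move=> /sd; exact: is_derive_phi.
have Dp1 s : s ^+ 2 < N x -> is_derive (s : R^o) (1 : R^o) (phi1 : R^o -> R^o) (phi2 s).
  by move=> /sd; exact: is_derive_phi1.
have Cp2 s : s ^+ 2 < N x -> {for s, continuous (phi2 : R^o -> R^o)}.
  by move=> /sd; exact: continuous_phi2.
have p0 s : s ^+ 2 < N x -> 0 < phi s by move=> /sd; exact: ab_phi_gt0 abF _.
have pc s : s ^+ 2 < N x -> 0 < phi s - s * phi1 s.
  by move=> /sd; exact: phi_conv0.
have Hy y : y != 0 -> hamel_at x phi phi1 phi2 y = 0.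
  exact: hamel_row_phi.
have [C0|/existsNP[y0 /eqP]] := pselect (forall y, curl (dcovec b x) y = 0).
  have [Q0|/existsNP[y0 /eqP Q0]] :=
    pselect (forall y, dot (y *m nabla a b x) y = 0).
    by left; apply/(nabla_eq0P _ openU riem Ux).
  by right; exact: (sym_linear Ms Mp (nabla_quad a b x) n3 Dp Dp1 Cp2 pc Hy C0 Q0).
move=> /rV0Pn[l Cl]; right.
have Cw : dot (curl (dcovec b x) y0) (evec l) != 0 by rewrite dot_evec.
exact: (curl_linear Ms Mp n3 Dp Dp1 p0 Hy Cw).
Qed.

(** Suppose that a slope [s] in the open range at [x] violates linearity.  Then
    [b] is parallel wherever its squared length exceeds [s^2].  Hence the square
    [f] of the excess of the squared length over [s^2] has derivative zero
    everywhere: its outer derivative vanishes where there is no excess, its inner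
    derivative where there is.  So [f] is constant on the component of [x] and
    positive at [x]; thus [b] is parallel on the whole component. *)
Lemma odd_part_linear (n3 : (3 <= n)%N) (ntF : nontrivial U a b) x s :
  U x -> s ^+ 2 < N x -> odd_part phi s = phi1 0 * s.
Proof.
move=> Ux sN; apply: contrapT => nlin; set T := s ^+ 2 in sN.
have par z : U z -> T < N z -> nabla a b z = 0.
  by move=> Uz TN; case: (nabla_or_linear n3 Uz) => // /(_ s TN).
pose f z : R^o := Num.max (N z - T) 0 ^+ 2.
have Df z v : U z -> is_derive z v f (0 : R).
  move=> Uz; have dN := differentiable_sqnorm openU riem sb Uz.
  have DN : is_derive z v (fun z => N z : R^o)
      (if T < N z then 0 : R else 'D_v (fun z => N z : R^o) z).
    case: ifPn => [TN|_]; first exact: (parallel_sqnorm openU riem sb v Uz (par z Uz TN)).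
    exact/derivableP/diff_derivable.
  refine (is_derive_eq (is_derive_comp_real
    (is_derive_subf DN (is_derive_cstf T z v)) (is_derive_sqr_pos _)) _).
  case: ifPn => [_|]; first by rewrite subr0 mulr0.
  by rewrite -leNgt => NT; rewrite max_r ?subr_le0 // mulr0 mul0r.
set K := connected_component U x.
have KU : K `<=` U := @connected_component_sub _ _ _.
have Kpar z : K z -> nabla a b z = 0.
  move=> Kz; apply: par; first exact: KU.
  have := locally_constant_component openU
    (fun w => @derive0_locally_constant _ _ U f w openU Df) Kz.
  rewrite /f (max_l (_ : 0 <= N x - T)) ?subr_ge0 ?ltW // => E.
  rewrite ltNge; apply/negP => NT; move: E; rewrite max_r ?subr_le0 //.
  move=> /eqP; rewrite expr0n eq_sym expf_eq0 /= subr_eq0 => /eqP E.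
  by move: sN; rewrite E ltxx.
apply: (ntF x Ux); split; last by apply/parallelP.
move=> z Kz; exists K, K, id, id.
have oK : open K by exact: open_connected_component.
split; first by split.
split=> //; [by move=> k; exact: Ck_on_id | by move=> k; exact: Ck_on_id |].
have -> : (fun u w => alpha a (id u) ('D_w id u)) = alpha a.
  by apply/funext => u; apply/funext => w; rewrite derive_id.
move=> u y Ku y0 l; have Uu := KU u Ku.
have [C0 Q0] := (nabla_eq0P _ openU riem Uu).1 (Kpar u Ku).
have Ms := riem_sym riem Uu; have Mp := riem_pos riem Uu.
have L0 : hamel_len (a u) (dmetric a u) y = 0.
  apply: (@parallel_hamel_len _ _ _ _ _ _ _ Ms Mp (nabla_quad a b u) phi phi1 phi2)
    => //.
  - by move=> t tN; apply: phi_conv0; exact: sqr_le_dom tN.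
  - move=> t tN; have := ab_phi_convex abF (sqr_le_norm Uu tN) (ab_norm abF Uu).
    by rewrite norm_formE sqr_sqrtr // sqnorm_ge0.
  - exact: hamel_row_phi.
have Dcst (k t : R) : setT t ->
    is_derive (t : R^o) (1 : R^o) ((fun=> k) : R^o -> R^o) (0 : R).
  by move=> _; exact: is_derive_cstf.
have slT w v : U w -> v != 0 -> setT (slope_at w v) by [].
have alE w v : U w -> alpha a w v = len (a w) v * (fun=> 1) (slope_at w v).
  by move=> _; rewrite mulr1 alphaE.
rewrite (hamel_formula openU riem sb (Dcst 1) (Dcst 0) slT alE l Uu y0).
by rewrite /hamel_row L0 scaler0 mul0r !scale0r !addr0 mxE.
Qed.

(** At the extreme slopes linearity follows by continuity. *)
Lemma odd_part_linear_le (n3 : (3 <= n)%N) (ntF : nontrivial U a b) x s :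
  U x -> s ^+ 2 <= N x -> odd_part phi s = phi1 0 * s.
Proof.
move=> Ux; rewrite le_eqVlt => /orP[/eqP sN|]; last exact: odd_part_linear.
have ds : dom s by apply: sqr_le_dom Ux _; rewrite sN.
have [->|s0] := eqVneq s 0; first by rewrite /odd_part oppr0 subrr !mulr0.
pose k t : R := odd_part phi t - phi1 0 * t.
suff : k s = 0 by move=> /eqP; rewrite subr_eq0 => /eqP.
have Ck : {for s, continuous (k : R^o -> R^o)}.
  apply: cvgB; last by apply: cvgM; [exact: cvg_cst | exact: cvg_id].
  apply: is_derive_continuous_real.
  by apply: is_derive_odd_part; apply: is_derive_phi => //; exact: domN.
apply/eqP/negPn/negP => ks.
have /nbhs_ballP[e /= e0 nK] : nbhs (s : R^o) [set z | k z != 0].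
  exact: (cvgr_neq0 (k s) Ck ks).
have s1 : 0 < `|s| by rewrite normr_gt0.
pose d := Num.min 2^-1 (e / (2 * `|s|)).
have d0 : 0 < d by rewrite lt_min invr_gt0 ltr0n divr_gt0 // mulr_gt0.
have d1 : d <= 2^-1 by rewrite ge_min lexx.
have dle : d * `|s| < e.
  have : d <= e / (2 * `|s|) by rewrite ge_min lexx orbT.
  rewrite ler_pdivlMr ?mulr_gt0 //; lra.
have : k (s * (1 - d)) != 0.
  apply: nK; rewrite -ball_normE /ball_ /=.
  rewrite (_ : s - s * (1 - d) = d * s); last by ring.
  by rewrite normrM gtr0_norm.
move/eqP; apply; rewrite /k (odd_part_linear n3 ntF Ux) ?subrr //.
rewrite -sN exprMn gtr_pMr; last by rewrite exprn_even_gt0.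
by nra.
Qed.

Hypotheses (n3 : (3 <= n)%N) (ntF : nontrivial U a b).

Let theta z : V := - phi1 0 *: b z.
Let G x y : R := F x y + one_form theta x y.
Let Gform x v : U x -> G x v = len (a x) v * even_part phi (slope_at x v).
Proof.
move=> Ux; rewrite /G ab_formE // -[one_form _ _ _]/(dot (theta x) v) dotZl.
have [->|v0] := eqVneq v 0.
  by rewrite dot0r mulr0 addr0 /len dot0r sqrtr0 !mul0r.
have := odd_part_linear_le n3 ntF Ux
  (slope_sqr_le (b x) (riem_sym riem Ux) (riem_pos riem Ux) v0).
have L0 := len_gt0 (riem_pos riem Ux) v0.
have -> : dot (b x) v = len (a x) v * slope_at x v.
  by rewrite mulrC divfK // gt_eqF.
move: (slope_at x v) => s; rewrite /odd_part /even_part => E.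
transitivity (len (a x) v * (phi s - phi1 0 * s)); first by ring.
by rewrite -E; field.
Qed.

Let Gmean x v : U x -> G x v = 2^-1 * (F x v + F x (- v)).
Proof.
by move=> Ux; rewrite Gform // !ab_formE // lenN slopeN /even_part; ring.
Qed.

Lemma is_derive_even_phi s : dom s ->
  is_derive (s : R^o) (1 : R^o) (even_part phi : R^o -> R^o) (odd_part phi1 s).
Proof.
move=> ds; apply: is_derive_even_part; apply: is_derive_phi => //.
exact: domN.
Qed.

Lemma is_derive_odd_phi s : dom s ->
  is_derive (s : R^o) (1 : R^o) (odd_part phi : R^o -> R^o) (even_part phi1 s).
Proof.
move=> ds; apply: is_derive_odd_part; apply: is_derive_phi => //.
exact: domN.
Qed.

Lemma is_derive_odd_phi1 s : dom s ->
  is_derive (s : R^o) (1 : R^o) (odd_part phi1 : R^o -> R^o) (even_part phi2 s).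
Proof.
move=> ds; apply: is_derive_odd_part; apply: is_derive_phi1 => //.
exact: domN.
Qed.

Lemma is_derive_even_phi1 s : dom s ->
  is_derive (s : R^o) (1 : R^o) (even_part phi1 : R^o -> R^o) (odd_part phi2 s).
Proof.
move=> ds; apply: is_derive_even_part; apply: is_derive_phi1 => //.
exact: domN.
Qed.

Let G_flat : projectively_flat U G.
Proof.
move=> x y Ux y0 l.
rewrite (hamel_formula openU riem sb is_derive_even_phi is_derive_odd_phi1
  slope_dom Gform l Ux y0).
by rewrite hamel_row_even !hamel_row_phi ?oppr_eq0 // addr0 scaler0 mxE.
Qed.

(** The odd part of [F] is [alpha psi (s)] both for [psi] the odd part of [phi],
    for which Hamel's operator vanishes, and for [psi s = phi' 0 s], for which it
    is the exterior derivative of [phi' 0 b] contracted with [y]. *)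
Let theta_closed : closed_form U theta.
Proof.
move=> x Ux i j.
pose O z v : R := phi1 0 * dot (b z) v.
have OE1 z v : U z -> O z v = len (a z) v * odd_part phi (slope_at z v).
  move=> Uz; have := Gform v Uz.
  rewrite /G ab_formE // -[one_form _ _ _]/(dot (theta z) v) dotZl /O => H.
  transitivity (len (a z) v * phi (slope_at z v) -
    len (a z) v * even_part phi (slope_at z v)).
    by rewrite -H; ring.
  by rewrite /odd_part /even_part; field.
have OE2 z v : U z -> O z v = len (a z) v * (phi1 0 * slope_at z v).
  move=> Uz; rewrite /O; have [->|v0] := eqVneq v 0.
    by rewrite dot0r /len dot0r sqrtr0 mul0r mulr0.
  rewrite /slope; field.
  by rewrite gt_eqF // (len_gt0 (riem_pos riem Uz)).
have Dl (t : R) : setT t ->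
    is_derive (t : R^o) (1 : R^o) ((fun s => phi1 0 * s) : R^o -> R^o) (phi1 0).
  move=> _; refine (is_derive_eq (is_derive_mulf (is_derive_cstf _ _ _)
    (is_derive_id _ _)) _).
  by ring.
have Dc (t : R) : setT t ->
    is_derive (t : R^o) (1 : R^o) ((fun=> phi1 0) : R^o -> R^o) (0 : R).
  by move=> _; exact: is_derive_cstf.
have slT w v : U w -> v != 0 -> setT (slope_at w v) by [].
have C y : phi1 0 *: curl (dcovec b x) y = 0.
  have [->|y0] := eqVneq y 0.
    by rewrite -(scale0r (0 : V)) curlZ !scale0r scaler0.
  apply/rowP => l.
  have := hamel_formula openU riem sb Dl Dc slT OE2 l Ux y0.
  rewrite (hamel_formula openU riem sb is_derive_odd_phi is_derive_even_phi1
    slope_dom OE1 l Ux y0).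
  rewrite hamel_row_odd !hamel_row_phi ?oppr_eq0 // subr0 scaler0 /hamel_row.
  by rewrite mulrC subrr mul0r !scale0r add0r addr0 => <-.
have Dtheta k l : 'D_(evec k) (fun z => theta z 0 l : R^o) x =
    - phi1 0 * dcovec b x k 0 l.
  rewrite (_ : (fun z => _) = - phi1 0 *: (fun z => b z 0 l : R^o)).
    by rewrite deriveZ ?mxE //; exact: derivable_entry sb Ux.
  by apply/funext => z; rewrite mxE.
rewrite !Dtheta.
have [->|p0] := eqVneq (phi1 0) 0; first by rewrite oppr0 !mul0r.
congr (_ * _); apply: (curl_eq0P b x).1 => y.
by have /eqP := C y; rewrite scaler_eq0 (negbTE p0) => /eqP.
Qed.

Let Ck_mean k (A : set (V * V)) : open A -> (forall p, A p -> U p.1) ->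
  (forall p, A p -> A (p.1, - p.2)) ->
  Ck_on k A (fun q : V * V => F q.1 q.2 : R^o) ->
  Ck_on k A (fun q : V * V => G q.1 q.2 : R^o).
Proof.
move=> oA AU AN CF; pose L (q : V * V) : V * V := (q.1, - q.2).
have linL : linear L.
  by move=> c u v; rewrite /L; congr pair; rewrite /= opprD scalerN.
have cL : continuous L.
  move=> q; apply: (@cvg_pair _ _ _ (nbhs q) (nbhs q.1) (nbhs (- q.2)) _ _ _
    fst (fun q => - q.2)); first exact: cvg_fst.
  by apply: cvgN; exact: cvg_snd.
have CFL : Ck_on k A (fun q : V * V => F q.1 (- q.2) : R^o).
  have := @Ck_on_affine _ _ _ _ k A _ L L linL cL _ CF.
  rewrite (_ : [set z | A (L z)] = A); last first.
    apply/seteqP; split=> q /=; last exact: AN.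
    by case: q => q1 q2 /AN /=; rewrite opprK.
  by apply=> z h; rewrite /L; congr pair; rewrite /= opprD.
apply: eq_Ck_on (Ck_onZ 2^-1 oA (Ck_onD oA CF CFL)) => // q Aq.
by rewrite Gmean //; exact: AU.
Qed.

Let G_gt0 x y : U x -> y != 0 -> 0 < G x y.
Proof.
move=> Ux y0; rewrite Gform // mulr_gt0 ?(len_gt0 (riem_pos riem Ux)) //.
rewrite /even_part mulr_gt0 // addr_gt0 //; apply: ab_phi_gt0 abF _ _.
  exact: slope_dom.
by apply: domN; exact: slope_dom.
Qed.

Let F_gt0 x y : U x -> y != 0 -> 0 < F x y.
Proof.
move=> Ux y0; rewrite ab_formE // mulr_gt0 ?(len_gt0 (riem_pos riem Ux)) //.
by apply: ab_phi_gt0 abF _ _; exact: slope_dom.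
Qed.

Let G_finsler : finsler_metric U G.
Proof.
have finF := ab_finsler abF.
have oUT : open [set p : V * V | U p.1].
  rewrite (_ : mkset _ = fst @^-1` U) //.
  by apply: open_comp => // p _; exact: cvg_fst.
split.
- move=> x y Ux; rewrite Gmean // mulr_ge0 ?invr_ge0 // addr_ge0 //;
    exact: finsler_ge0 finF _ _ Ux.
- by apply: (@Ck_mean 0%N [set p | U p.1]) => //; exact: finsler_continuous finF.
- move=> k; apply: Ck_mean.
  + rewrite (_ : mkset _ = [set p : V * V | U p.1] `&` snd @^-1` [set v | v != 0]) //.
    apply: openI => //; apply: open_comp; last exact: open_nonzero.
    by move=> p _; exact: cvg_snd.
  + by move=> p [].
  + by move=> p [Up p0]; split=> //=; rewrite oppr_eq0.
  + exact: finsler_smooth finF k.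
- move=> x y c Ux c0; rewrite !Gmean // -scalerN.
  by rewrite !(finsler_homogeneous finF) // mulrCA -mulrDr.
- move=> x y Ux y0; apply: (posdef_fundamental_shift finF Ux y0).
    exact: F_gt0.
  exact: G_gt0.
Qed.

Let G_reversible : reversible U G.
Proof.
move=> x y c Ux; rewrite !Gform //.
have -> : len (a x) (c *: y) = `|c| * len (a x) y.
  rewrite /len -scalemxAl !dotL mulrA -expr2 sqrtrM ?sqr_ge0 //.
  by rewrite sqrtr_sqr.
rewrite -mulrA.
have [->|c0] := eqVneq c 0; first by rewrite normr0 !mul0r.
congr (_ * (_ * _)).
have slE : slope_at x (c *: y) = Num.sg c * slope_at x y.
  rewrite /slope /len -scalemxAl !dotL mulrA -expr2 sqrtrM ?sqr_ge0 //.
  rewrite sqrtr_sqr invfM mulrACA; congr (_ * _).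
  by rewrite {1}(numEsg c) mulfK // normr_eq0.
rewrite slE; case: (sgrP c) c0 => //= _ _; first by rewrite mul1r.
by rewrite mulN1r /even_part opprK addrC.
Qed.

Let G_ab : ab_metric U a b (even_part phi) bo G.
Proof.
have D1 s : dom s -> derive1 (even_part phi) s = odd_part phi1 s.
  by move=> ds; rewrite derive1E (@derive_val _ _ _ _ _ _ _ (is_derive_even_phi ds)).
have D2 s : dom s -> derive1n 2 (even_part phi) s = even_part phi2 s.
  move=> ds; rewrite derive1nS derive1n1 derive1E.
  rewrite -(@derive_val _ _ _ _ _ _ _ (is_derive_odd_phi1 ds)).
  by apply: near_eq_derive; apply: near_open open_dom ds _.
split=> //; try by case: abF.
- move=> k; have CF := ab_phi_smooth abF k.
  have CN : Ck_on k (dom : set R^o) ((fun s => phi (- s)) : R^o -> R^o).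
    have := @Ck_on_affine R R^o R^o R^o k dom phi -%R -%R _ _ _ CF.
    rewrite (_ : [set z | _] = dom); last first.
      by apply/seteqP; split=> s; rewrite /= normrN.
    apply.
    - by move=> c u v; rewrite opprD scalerN.
    - exact: opp_continuous.
    - by move=> z h; rewrite opprD.
  exact: Ck_onZ open_dom (Ck_onD open_dom CF CN).
- move=> s ds; rewrite /even_part mulr_gt0 // addr_gt0 //.
    exact: ab_phi_gt0 abF _ ds.
  exact: ab_phi_gt0 abF _ (domN ds).
- by rewrite /even_part oppr0 (ab_phi0 abF); field.
- move=> s c sc cb; have ds := dom_le sc cb.
  rewrite D1 // D2 //.
  have := ab_phi_convex abF sc cb.
  have := ab_phi_convex abF (_ : `|- s| <= c) cb; rewrite normrN => /(_ sc).
  by rewrite sqrrN /even_part /odd_part; lra.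
- move=> x y Ux; rewrite Gform //.
  by rewrite alphaE.
Qed.

Lemma reversible_shift : exists theta : V -> V,
  [/\ smooth_on U theta, closed_form U theta &
    let G := fun x y => F x y + one_form theta x y in
    [/\ reversible U G, projectively_flat U G &
      exists (a' : V -> 'M[R]_n) (b' : V -> V) (phi' : R -> R) (bo' : \bar R),
        ab_metric U a' b' phi' bo' G]].
Proof.
exists theta; split.
- by move=> k; apply: Ck_onZ => //; exact: sb.
- exact: theta_closed.
split; [exact: G_reversible | exact: G_flat |].
by exists a, b, (even_part phi), bo; exact: G_ab.
Qed.

End Flat.
End ReversiblePart.

Theorem theorem8p1 (R : realType) (n : nat) (hn : (3 <= n)%N)
    (U : set 'rV[R]_n) (a : 'rV[R]_n -> 'M[R]_n) (b : 'rV[R]_n -> 'rV[R]_n)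
    (phi : R -> R) (bo : \bar R) (F : 'rV[R]_n -> 'rV[R]_n -> R)
    (openU : open U)
    (abF : ab_metric U a b phi bo F)
    (ntF : nontrivial U a b)
    (pfF : projectively_flat U F) :
  exists theta : 'rV[R]_n -> 'rV[R]_n,
    [/\ smooth_on U theta, closed_form U theta &
        let G := fun x y => F x y + one_form theta x y in
        [/\ reversible U G, projectively_flat U G &
            exists (a' : 'rV[R]_n -> 'M[R]_n) (b' : 'rV[R]_n -> 'rV[R]_n)
                   (phi' : R -> R) (bo' : \bar R),
              ab_metric U a' b' phi' bo' G]].
Proof. exact: reversible_shift openU abF pfF hn ntF. Qed.
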